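(* Run Expected TD-PMD (defined in the context) with behavior policy $\pi_b$. Assume: (i) $\tilde\pi_b:=\min_{(s,a)\in\mathcal S\times\mathcal A}\pi_b(a|s)>0$; (ii) the state transition matrix $P^{\pi_b}_{\mathcal S}$ is ergodic over $\mathcal S$; (iii) the mirror map $h$ is $\lambda$-strongly convex ($\lambda>0$) with respect to the $\ell_p$-norm over $\Delta(\mathcal A)$ for some constant $p\in[1,+\infty]$. Fix any optimal policy $\pi^*\in\Pi^*$ and any $\mu\in\Delta(\mathcal S)$. Let, for all $k$, $$\eta_k=\eta=\sqrt{\frac{\alpha\lambda\tilde\sigma_b^2(1-\gamma)^4\|D^{\pi^*}_{\pi_0}\|_\infty}{6|\mathcal A|^2(K+1)}},\qquad \alpha_k=\alpha\in(0,1],\qquad B_k=B>0,$$ and let the weights be $c_t^k=\vartheta^{B_k-t-1}\big/\sum_{i=0}^{B_k-1}\vartheta^{i}$ for a preset $\vartheta\in[0,1]$ (with $0^0=1$). Then $$\mathbb E\big[V^*(\mu)-V^{\pi_{\hat K}}(\mu)\big]\le \frac{1}{K+1}\cdot\frac{3}{\alpha\tilde\sigma_b(1-\gamma)^3}+\frac{2}{\sqrt{K+1}}\left(\frac{6|\mathcal A|^2\|D^{\pi^*}_{\pi_0}\|_\infty}{\alpha\lambda\tilde\sigma_b^2(1-\gamma)^6}\right)^{1/2}+\frac{2}{\tilde\sigma_b(1-\gamma)^2}\Psi(B,\vartheta,m_b,\kappa_b),$$ where $\hat K$ is uniform on $\{0,1,\dots,K\}$ (independent of everything else) and $$\Ps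i(B,\vartheta,m_b,\kappa_b)=\begin{cases}\dfrac{m_b}{(1-\gamma)(\kappa_b-\vartheta)}\,\kappa_b^{B},&0\le\vartheta<\kappa_b,\\[1em]\dfrac{m_b}{1-\gamma}\,B\,\vartheta^{B-1},&\vartheta=\kappa_b,\\[1em]\dfrac{m_b}{(1-\gamma)(\vartheta-\kappa_b)}\,\vartheta^{B},&\kappa_b<\vartheta<1,\\[1em]\dfrac{m_b}{B(1-\gamma)(1-\kappa_b)},&\vartheta=1.\end{cases}$$
   Context: MDP: $\mathcal S,\mathcal A$ are finite nonempty sets, $P(\cdot|s,a)\in\Delta(\mathcal S)$ is the transition kernel, $r:\mathcal S\times\mathcal A\to[0,1]$ the reward, $\gamma\in[0,1)$ the discount factor; $\Delta(X)$ is the set of probability distributions on $X$. A policy is $\pi:\mathcal S\to\Delta(\mathcal A)$; $\Pi$ is the set of all policies. $V^\pi(s)=\mathbb E[\sum_{t\ge0}\gamma^t r(s_t,a_t)\mid s_0=s,\pi]$, $V^\pi(\mu)=\mathbb E_{s\sim\mu}[V^\pi(s)]$, $V^*(s)=\max_{\pi\in\Pi}V^\pi(s)$, and $\Pi^*=\{\pi\in\Pi: V^\pi=V^*\}$ (nonempty). Mirror map: $h$ is a proper, closed, strictly convex, essentially smooth function on $\mathbb R^{|\mathcal A|}$, finite on $\Delta(\mathcal A)$, with $\mathrm{rint\,dom}\,h\cap\Delta(\mathcal A)\neq\emptyset$. $D_h(p\|q)=h(p)-h(q)-\langle\nabla h(q),p-q\rangle$; $D^{\pi}_{\pi'}(s)=D_h(\pi(\cdot|s)\|\pi'(\cdot|s))$,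 $D^{p}_{\pi'}(s)=D_h(p\|\pi'(\cdot|s))$, $\|D^\pi_{\pi'}\|_\infty=\max_s D^\pi_{\pi'}(s)$. The initial policy satisfies $\pi_0(\cdot|s)\in\mathrm{rint\,dom}\,h$ for all $s$. Expected TD-PMD. Inputs: $K$, a behavior policy $\pi_b$, $Q^0=0\in\mathbb R^{|\mathcal S||\mathcal A|}$, $\pi_0$, critic step sizes $\alpha_k$, policy step sizes $\eta_k\ge0$, initial state $s_0$, batch sizes $B_k$ (positive integers), weights $c_t^k\ge0$ with $\sum_{t=0}^{B_k-1}c^k_t=1$. Set $s_0^0=s_0$. For $k=0,1,\dots,K$: (1) for every $s$, $\pi_{k+1}(\cdot|s)=\arg\max_{p\in\Delta(\mathcal A)}\{\eta_k\langle p,Q^k(s,\cdot)\rangle-D^p_{\pi_k}(s)\}$; (2) starting from $s_0^k$ sample, for $t=0,\dots,B_k-1$, $a_t^k\sim\pi_b(\cdot|s_t^k)$, $r_t^k=r(s_t^k,a_t^k)$, $s_{t+1}^k\sim P(\cdot|s_t^k,a_t^k)$, and set $s_0^{k+1}=s_{B_k}^k$; (3) with $\delta_t^k(s,a)=\mathbf 1_{(s_t^k,a_t^k)=(s,a)}\big[r_t^k+\gamma\,\mathbb E_{a'\sim\pi_{k+1}(\cdot|s_{t+1}^k)}[Q^k(s_{t+1}^k,a')]-Q^k(s_t^k,a_t^k)\big]$ and $\bar\delta_k=\sum_{t=0}^{B_k-1}c_t^k\delta_t^k$, set $Q^{k+1}=Q^k+\alpha_k\bar\delta_k$. Behavior chain: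 $P^{\pi_b}_{\mathcal S}(s,s')=\sum_a\pi_b(a|s)P(s'|s,a)$. When it is ergodic (irreducible and aperiodic) it has a unique stationary distribution $\nu^{\pi_b}$, all of whose entries are positive, and there are constants $m_b>0$, $\kappa_b\in(0,1)$ such that the induced Markov chain $\{s_t\}$ satisfies $d_{TV}(\nu^{\pi_b},\mathbb P(s_{n+t}=\cdot\mid s_n=s))\le m_b\kappa_b^t$ for all $s$, $n,t\ge0$ ($d_{TV}$ = total variation distance); $m_b,\kappa_b$ denote such constants. $\sigma^{\pi_b}(s,a)=\nu^{\pi_b}(s)\pi_b(a|s)$ and $\tilde\sigma_b=\min_{s,a}\sigma^{\pi_b}(s,a)>0$. *)

(* Defs.v *)
From HB Require Import structures.
From mathcomp Require Import all_boot all_order all_algebra.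
From mathcomp Require Import all_classical all_reals all_analysis.

Set Implicit Arguments.
Unset Strict Implicit.
Unset Printing Implicit Defensive.

Import Order.TTheory GRing.Theory Num.Theory.
Import numFieldNormedType.Exports.

Local Open Scope classical_set_scope.
Local Open Scope ring_scope.

Section Distributions.
Context {R : realType}.

Definition simplex (X : finType) : set (X -> R) :=
  [set p | (forall x, 0 <= p x) /\ \sum_x p x = 1].

Definition tv_dist (X : finType) (p q : X -> R) : R :=
  2^-1 * \sum_x `|p x - q x|.

Definition expect (X : finType) (p f : X -> R) : R := \sum_x p x * f x.

(* The unit 1 of the iterated minimum is harmless: this is only applied to
   families of probabilities, all of which are at most 1. *)
Definition min_prob (X Y : finType) (f : X -> Y -> R) : R :=
  \big[Num.min/1]_(z : X * Y) f z.1 z.2.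

End Distributions.

Section MDP.
Context {R : realType} {S A : finType}.

Record mdp := MDP {
  trans : S -> A -> S -> R;
  reward : S -> A -> R;
  discount : R;
  state_nonempty : (0 < #|S|)%N;
  action_nonempty : (0 < #|A|)%N;
  trans_simplex : forall s a, simplex (trans s a);
  reward_itv : forall s a, 0 <= reward s a <= 1;
  discount_itv : 0 <= discount < 1 }.

Definition policies : set (S -> A -> R) := [set pi | forall s, simplex (pi s)].

Variable M : mdp.

Section Trajectories.
Context {d : measure_display} {Omega : measurableType d}.
Variables (X : nat -> Omega -> S) (Y : nat -> Omega -> A).

Definition traj_event (N : nat) (x : nat -> S) (y : nat -> A) : set Omega :=
  [set w | (forall t, (t <= N)%N -> X t w = x t) /\
           (forall t, (t < N)%N -> Y t w = y t)].

(* (X_0, Y_0, X_1, ..., Y_{N-1}, X_N) is distributed as N steps of the MDP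
   from s under pi: Y_t ~ pi(.|X_t) and X_{t+1} ~ trans(.|X_t, Y_t). *)
Definition is_trajectory (P : probability Omega R) (pi : S -> A -> R) (s : S)
    (N : nat) : Prop :=
  [/\ forall t, (t <= N)%N -> forall z, measurable (X t @^-1` [set z]),
      forall t, (t < N)%N -> forall b, measurable (Y t @^-1` [set b])
    & forall x y, P (traj_event N x y) =
        ((x 0 == s)%:R *
         \prod_(t < N) (pi (x t) (y t) * trans M (x t) (y t) (x t.+1)))%:E].

Definition discounted_return (w : Omega) : R :=
  limn (fun n => \sum_(t < n) discount M ^+ t * reward M (X t w) (Y t w)).

End Trajectories.

(* V^pi(s) is the expected discounted return of an infinite trajectory from s
   under pi; the expectation is the same for all such trajectories, whatever
   probability space carries them. *)
Definition value (pi : S -> A -> R) (s : S) : R :=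
  get [set v : R | exists (d : measure_display) (Omega : measurableType d)
    (P : probability Omega R) (X : nat -> Omega -> S) (Y : nat -> Omega -> A),
    (forall N, is_trajectory X Y P pi s N) /\
    ('E_P[discounted_return X Y] = v%:E)%E].

Definition opt_value (s : S) : R := sup [set value pi s | pi in policies].

Definition optimal : set (S -> A -> R) :=
  [set pi | policies pi /\ forall s, value pi s = opt_value s].

End MDP.

Section MarkovChain.
Context {R : realType} {S A : finType}.

Definition state_trans (M : @mdp R S A) (pi : S -> A -> R) (s s' : S) : R :=
  \sum_a pi s a * trans M s a s'.

Variable T : S -> S -> R.

Fixpoint steps (t : nat) (s s' : S) : R :=
  if t is t'.+1 then \sum_z T s z * steps t' z s' else (s == s')%:R.

Definition irreducible : Prop := forall s s', exists t, 0 < steps t s s'.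

Definition aperiodic : Prop := forall s g,
  (forall t, (0 < t)%N -> 0 < steps t s s -> (g %| t)%N) -> g = 1%N.

Definition ergodic : Prop := irreducible /\ aperiodic.

Definition stationary (nu : S -> R) : Prop :=
  simplex nu /\ forall s', \sum_s nu s * T s s' = nu s'.

End MarkovChain.

Section Convex.
Context {R : realType} {n : nat}.
Local Notation E := 'rV[R]_n.
Implicit Types (C : set E) (h : E -> \bar R).

Definition affine_hull C : set E :=
  [set x | exists (m : nat) (c : 'I_m -> R) (v : 'I_m -> E),
    [/\ \sum_i c i = 1, forall i, C (v i) & x = \sum_i c i *: v i]].

Definition rel_interior C : set E :=
  [set x | C x /\ within (affine_hull C) (nbhs x) C].

Definition dom h : set E := [set x | (h x < +oo)%E].

Definition proper h : Prop := (forall x, h x != -oo%E) /\ dom h !=set0.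

Definition strictly_convex h : Prop := forall x y (t : R),
  dom h x -> dom h y -> x != y -> 0 < t < 1 ->
  (h (t *: x + (1 - t) *: y)%R < t%:E * h x + (1 - t)%:E * h y)%E.

Definition grad h (x : E) : E :=
  \row_i 'd (fine \o h) x (delta_mx 0 i).

(* Rockafellar's notion; the condition on u and x says that the gradient blows
   up at the boundary of the interior of the domain. *)
Definition essentially_smooth h : Prop :=
  [/\ (dom h)° !=set0,
      forall x, (dom h)° x -> differentiable (fine \o h) x
    & forall (u : nat -> E) (x : E), (forall k, (dom h)° (u k)) ->
        ~ (dom h)° x -> u @ \oo --> x -> `|grad h (u k)| @[k --> \oo] --> +oo].

Definition lp_norm (p : \bar R) (x : E) : R :=
  match p with
  | q%:E => (\sum_i `|x 0 i| `^ q) `^ q^-1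
  | _ => \big[Num.max/0]_i `|x 0 i|
  end.

Definition strongly_convex_on C (lambda : R) (p : \bar R) h : Prop :=
  forall x y (t : R), C x -> C y -> 0 <= t <= 1 ->
  (h (t *: x + (1 - t) *: y)%R <= t%:E * h x + (1 - t)%:E * h y
     - (lambda / 2 * t * (1 - t) * lp_norm p (x - y) ^+ 2)%:E)%E.

(* Only used where h x and h y are finite. *)
Definition bregman h (x y : E) : R :=
  fine (h x) - fine (h y) - \sum_i grad h y 0 i * (x - y) 0 i.

End Convex.

Section PMD.
Context {R : realType} {S A : finType}.

(* Identifies a function on A with a vector of R^|A|. *)
Definition vec (p : A -> R) : 'rV[R]_#|A| := \row_i p (enum_val i).

Definition vsimplex : set 'rV[R]_#|A| := vec @` @simplex R A.

Record mirror_map (h : 'rV[R]_#|A| -> \bar R) : Prop := MirrorMap {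
  mirror_proper : proper h;
  mirror_closed : lower_semicontinuous h;
  mirror_strictly_convex : strictly_convex h;
  mirror_essentially_smooth : essentially_smooth h;
  mirror_finite : forall x, vsimplex x -> h x \is a fin_num;
  mirror_rint : rel_interior (dom h) `&` vsimplex !=set0 }.

Variable h : 'rV[R]_#|A| -> \bar R.

Definition action_div (p q : A -> R) : R := bregman h (vec p) (vec q).

(* The unit 0 of the iterated maximum is harmless, divergences being
   nonnegative. *)
Definition div_norm (pi pi' : S -> A -> R) : R :=
  \big[Num.max/0]_s action_div (pi s) (pi' s).

Definition pmd_objective (eta : R) (q p0 p : A -> R) : R :=
  eta * expect p q - action_div p p0.

Definition pmd_step (eta : R) (q p0 p : A -> R) : Prop :=
  simplex p /\ forall p', simplex p' ->
    pmd_objective eta q p0 p' <= pmd_objective eta q p0 p.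

Variable M : @mdp R S A.

Definition td_error (Q pi : S -> A -> R) (st : S) (at_ : A) (st' : S)
    (s : S) (a : A) : R :=
  ((st == s) && (at_ == a))%:R *
  (reward M st at_ + discount M * expect (pi st') (Q st') - Q st at_).

(* The samples of all the batches form a single trajectory
   X_0, Y_0, X_1, Y_1, ...; batch k starts at time batch_start B k. *)
Definition batch_start (B : nat -> nat) (k : nat) : nat := \sum_(j < k) B j.

Definition td_pmd_run (K : nat) (pi0 : S -> A -> R) (eta alpha : nat -> R)
    (B : nat -> nat) (c : nat -> nat -> R) (X : nat -> S) (Y : nat -> A)
    (Q pi : nat -> S -> A -> R) : Prop :=
  [/\ pi 0%N = pi0, forall s a, Q 0%N s a = 0 &
   forall k, (k <= K)%N ->
     (forall s, pmd_step (eta k) (Q k s) (pi k s) (pi k.+1 s)) /\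
     (forall s a, Q k.+1 s a = Q k s a + alpha k *
        \sum_(t < B k) c k t *
          let i := (batch_start B k + t)%N in
          td_error (Q k) (pi k.+1) (X i) (Y i) (X i.+1) s a)].

End PMD.

Section Bound.
Context {R : realType}.

Definition geometric_weight (theta : R) (B t : nat) : R :=
  theta ^+ (B - t - 1) / \sum_(i < B) theta ^+ i.

Definition Psi (gamma : R) (B : nat) (theta m kappa : R) : R :=
  if theta < kappa then m / ((1 - gamma) * (kappa - theta)) * kappa ^+ B
  else if theta == kappa then m / (1 - gamma) * B%:R * theta ^+ (B - 1)
  else if theta < 1 then m / ((1 - gamma) * (theta - kappa)) * theta ^+ B
  else m / (B%:R * (1 - gamma) * (1 - kappa)).

(* Given the trajectory up to time N, the index Khat is uniform on {0..K}. *)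
Definition independent_uniform (S A : finType) (d : measure_display)
    (Omega : measurableType d) (P : probability Omega R)
    (X : nat -> Omega -> S) (Y : nat -> Omega -> A) (N K : nat)
    (Khat : Omega -> 'I_K.+1) : Prop :=
  [/\ forall j, measurable (Khat @^-1` [set j]),
      forall j, P (Khat @^-1` [set j]) = (K.+1%:R^-1)%:E
    & forall j x y, P (Khat @^-1` [set j] `&` traj_event X Y N x y) =
        (P (Khat @^-1` [set j]) * P (traj_event X Y N x y))%E].

End Bound.

(* Main.v *)
(* Write q = 1 / (1 - gamma), V = <pi_{k+1}, Q^k> and let
   R_k = r + gamma P V - Q^k be the Bellman residual of Q^k under pi_{k+1}.
   Two performance differences, through V, give exactly
     V*(mu) - V^{pi_k}(mu) = <w* - w_k, R_k>
       + E_{d*} <pi* - pi_{k+1}, Q^k> + E_{d_k} <pi_{k+1} - pi_k, Q^k>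
   where d* and d_k are the unnormalized discounted occupancies of pi* and
   pi_k and w*, w_k the corresponding state-action occupancies.  The second
   term telescopes by the three-point inequality of mirror descent, the third
   is O(eta) by strong convexity.  Up to the mixing error of the behavior chain,
   the conditional expectation of Q^{k+1} - Q^k is alpha sigma R_k, and w_k is
   known at the start of batch k; so the first term is, in expectation,
   <(w* - w_k) / (alpha sigma), Q^{k+1} - Q^k>, to be summed by parts over k:
   Q^k stays in [0, q] and w_k moves by O(eta) at each step. *)
Require Import Defs.
From mathcomp Require Import all_boot all_order all_algebra.
From mathcomp Require Import all_classical all_reals all_analysis.
From mathcomp Require Import ring lra.
Import Order.TTheory GRing.Theory Num.Theory.
Import numFieldNormedType.Exports.
Local Open Scope classical_set_scope.
Local Open Scope ring_scope.
Set Implicit Arguments.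
Unset Strict Implicit.
Unset Printing Implicit Defensive.

(** * Convex functions and mirror descent *)

(** Three obstacles shape the proof. The gradient of [h] makes sense only in the interior of its
    domain, so every policy of the run has to be shown to stay there before a first-order condition
    can be written; this is where essential smoothness enters. [Q] and [pi] are arbitrary functions
    of the sample point that satisfy the recursion pointwise; that they depend on the sampled
    history alone is derived from the uniqueness of the mirror step, after which expectations become
    finite sums over histories. Finally, [value] is picked by [get] among the expected returns of
    all trajectories, so an infinite trajectory has to be built before [value] can be identified
    with the occupancy formula [policy_value]. The rate comes from the summation by parts: instead
    of [K + 1] residuals one pays a boundary value and the total variation of the occupancies, of
    order [K * eta]. At the chosen step both [K * eta] and [1 / eta] are of order [sqrt K]. *)

Lemma tangent_slope_le (R : realType) (t a b c d fy fz fv : R) : 0 < t <= 1 ->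
  c <= a -> fy + (d + (1 - t) * a) <= fv -> fz + (1 - t) * b <= fy ->
  fv <= fz + 1 -> d <= 1 + `|c| + `|b|.
Proof.
move=> /andP[t0 t1] ca T1 T2 T3.
have A1 : - `|c| <= (1 - t) * a.
  have := ler_norm (- c); rewrite normrN => nc; have := normr_ge0 c => nc0.
  by nra.
have A2 : - ((1 - t) * b) <= `|b|.
  have := ler_norm (- b); rewrite normrN => nb; have := normr_ge0 b => nb0.
  by nra.
by lra.
Qed.

Lemma row_norm_le (R : realType) (n : nat) (u : 'rV[R]_n) (M : R) :
  0 <= M -> (forall i, `|u 0 i| <= M) -> `|u| <= M.
Proof.
move=> M0 H; rewrite /Num.Def.normr /= mx_normrE.
by apply: bigmax_le => // -[j i] _ /=; rewrite (ord1 j).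
Qed.

Section Dot.
Context {R : realType} {n : nat}.
Implicit Types g v w : 'rV[R]_n.

Definition dot g v : R := \sum_i g 0 i * v 0 i.

Lemma dotDr g v w : dot g (v + w) = dot g v + dot g w.
Proof. by rewrite -big_split; apply: eq_bigr => i _; rewrite mxE mulrDr. Qed.

Lemma dotZr g (c : R) v : dot g (c *: v) = c * dot g v.
Proof. by rewrite big_distrr; apply: eq_bigr => i _; rewrite mxE mulrCA. Qed.

Lemma dotNr g v : dot g (- v) = - dot g v.
Proof. by rewrite -scaleN1r dotZr mulN1r. Qed.

(** The algebra of the three-point inequality: [g0] and [g] stand for the gradients of [h] at [x0]
    and [x], and [a0], [a], [a'] for its values at [x0], [x], [x']. The premise is the first-order
    optimality of [x]. *)
Lemma dot_three_point g0 g q x0 x x' (eta a0 a a' : R) :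
  eta * dot q (x' - x) + dot g0 (x' - x) <= dot g (x' - x) ->
  eta * (dot q x' - dot q x) <=
  a' - a0 - dot g0 (x' - x0) - (a' - a - dot g (x' - x))
  - (a - a0 - dot g0 (x - x0)).
Proof. by rewrite !dotDr !dotNr; lra. Qed.

Lemma dot0 g : dot g 0 = 0.
Proof. by apply: big1 => i _; rewrite mxE mulr0. Qed.

Lemma dot_delta g i : dot g (delta_mx 0 i) = g 0 i.
Proof.
rewrite /dot (bigD1 i)//= big1 ?addr0 ?mxE ?eqxx ?mulr1// => l li.
by rewrite mxE (negPf li) mulr0.
Qed.

(** The norm is the sup norm, so it suffices to test [g] on plus and minus each basis vector, scaled
    by [e / 2] to stay inside the ball. *)
Lemma dot_bound_norm g (e C : R) : 0 < e -> 0 <= C ->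
  (forall v, `|v| < e -> dot g v <= C) -> `|g| <= C / (e / 2).
Proof.
move=> e0 C0 H; have e20 : 0 < e / 2 by rewrite divr_gt0.
have M0 : 0 <= C / (e / 2) by rewrite divr_ge0// ltW.
apply: row_norm_le => // i.
have key (s : R) : `|s| = 1 -> s * g 0 i <= C / (e / 2).
  move=> s1; rewrite ler_pdivlMr// mulrAC -dot_delta -dotZr; apply: H.
  have d1 : `|delta_mx 0 i : 'rV[R]_n| <= 1.
    apply: row_norm_le => // l.
    by rewrite mxE; case: (_ && _); rewrite ?normr1 ?normr0.
  rewrite normrZ normrM s1 mul1r gtr0_norm//.
  have := normr_ge0 (delta_mx 0 i : 'rV[R]_n) => d0.
  by nra.
rewrite ler_norml lerNl -mulN1r key ?normrN ?normr1//.
by rewrite -[leLHS]mul1r key// normr1.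
Qed.

End Dot.

Section ConvexFunctions.
Context {R : realType} {n : nat} (h : 'rV[R]_n -> \bar R).
Hypothesis h_proper : Defs.proper h.
Hypothesis h_convex : strictly_convex h.
Hypothesis h_smooth : essentially_smooth h.
Implicit Types x y z v : 'rV[R]_n.

Local Notation f := (fine \o h).

Lemma dom_fin x : dom h x -> h x = (f x)%:E.
Proof.
move=> hx; rewrite /= fineK// fin_numE -ltey; apply/andP; split=> //.
by case: h_proper.
Qed.

Lemma convex_comb x y (t : R) : dom h x -> dom h y -> 0 <= t <= 1 ->
  dom h (t *: x + (1 - t) *: y) /\
  f (t *: x + (1 - t) *: y) <= t * f x + (1 - t) * f y.
Proof.
move=> hx hy /andP[t0 t1].
have [->|xy] := eqVneq x y.
  by rewrite -scalerDl addrCA subrr addr0 scale1r; split=> //; lra.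
have [->|tn0] := eqVneq t 0.
  by rewrite scale0r subr0 scale1r add0r; split=> //; lra.
have [->|tn1] := eqVneq t 1.
  by rewrite subrr scale0r scale1r addr0; split=> //; lra.
have /(h_convex hx hy xy) : 0 < t < 1 by rewrite !lt_neqAle eq_sym tn0 t0 tn1 t1.
rewrite (dom_fin hx) (dom_fin hy) -!EFinM -EFinD => H.
have D : dom h (t *: x + (1 - t) *: y) by apply: lt_trans H (ltry _).
by split=> //; apply/ltW; move: H; rewrite (dom_fin D) lte_fin.
Qed.

Lemma grad_dotE x v : differentiable f x -> dot (grad h x) v = 'd f x v.
Proof.
move=> fx; rewrite [in RHS](row_sum_delta v) linear_sum; apply: eq_bigr => i _.
by rewrite linearZ /= mxE mulrC.
Qed.

Lemma diff_quotient x v : differentiable f x ->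
  t^-1 * (f (x + t *: v) - f x) @[t --> (0:R)^'+] --> dot (grad h x) v.
Proof.
move=> fx; rewrite grad_dotE// -deriveE//; apply: cvg_dnbhs_at_right.
have E : (fun t => t^-1 *: ((f \o shift x) (t *: v) - f x)) =
         (fun t => t^-1 * (f (x + t *: v) - f x)).
  by apply/funext => t; rewrite /= [_ + x]addrC.
have := @diff_derivable _ _ _ _ _ v fx; rewrite /derivable /derive E; exact.
Qed.

(** The slack [t * b] vanishes in the limit; it leaves room for the quadratic term of strong
    convexity. *)
Lemma diff_le x v (a b : R) : differentiable f x ->
  (forall t, 0 < t <= 1 -> f (x + t *: v) - f x <= t * (a + t * b)) ->
  dot (grad h x) v <= a.
Proof.
move=> fx H; have L : (a + t * b) @[t --> (0:R)^'+] --> a.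
  apply: cvg_at_right_filter.
  rewrite -[X in _ --> X]addr0 -[X in _ + X](mul0r b).
  by apply: cvgD; [exact: cvg_cst|apply: cvgMr_tmp; exact: cvg_id].
apply: (ler_cvg_to (diff_quotient fx) L); near=> t.
have t0 : 0 < t by near: t; exact: nbhs_right_gt.
have t1 : t <= 1 by near: t; apply: nbhs_right_le.
by rewrite mulrC ler_pdivrMr// [_ * t]mulrC H ?t0.
Unshelve. all: by end_near. Qed.

Lemma diff_ge x v (a : R) : differentiable f x ->
  (forall t, 0 < t <= 1 -> t * a <= f (x + t *: v) - f x) ->
  a <= dot (grad h x) v.
Proof.
move=> fx H; apply: (ler_cvg_to (cvg_cst a) (diff_quotient fx)); near=> t.
have t0 : 0 < t by near: t; exact: nbhs_right_gt.
have t1 : t <= 1 by near: t; apply: nbhs_right_le.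
by rewrite [_^-1 * _]mulrC ler_pdivlMr// mulrC H ?t0.
Unshelve. all: by end_near. Qed.

Lemma smooth_interior x : (dom h)° x -> differentiable f x.
Proof. by case: h_smooth => _ + _; apply. Qed.

Lemma tangent_le x y : (dom h)° x -> dom h y -> f x + dot (grad h x) (y - x) <= f y.
Proof.
move=> ix hy; have hx : dom h x := interior_subset ix.
suff : dot (grad h x) (y - x) <= f y - f x by lra.
apply: (@diff_le _ _ _ 0); first exact: smooth_interior.
move=> t /andP[t0 t1]; rewrite mulr0 addr0.
have -> : x + t *: (y - x) = t *: y + (1 - t) *: x.
  by rewrite scalerBr scalerBl scale1r addrCA addrA addrAC.
have t01 : 0 <= t <= 1 by lra.
by have [_] := convex_comb hy hx t01; lra.
Qed.

(** The ball of radius [t * e] around the new point is the image of the ball of radius [e] around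
    [z] under the contraction of centre [x] and ratio [t]; convexity keeps this image in the domain,
    even when [x] lies on the boundary. *)
Lemma segment_interior x z (t : R) : dom h x -> (dom h)° z -> 0 < t <= 1 ->
  (dom h)° (x + t *: (z - x)).
Proof.
move=> hx /nbhs_ballP[e /= e0 ez] /andP[t0 t1].
apply/nbhs_ballP; exists (t * e); first exact: mulr_gt0.
move=> u; rewrite -ball_normE /= => ub.
have -> : u = t *: (z + t^-1 *: (u - (x + t *: (z - x)))) + (1 - t) *: x.
  rewrite scalerDr scalerA divff ?gt_eqF// scale1r scalerBl scale1r scalerBr.
  by apply/rowP=> i; rewrite !mxE; ring.
have t01 : 0 <= t <= 1 by lra.
apply: (convex_comb _ hx t01).1; apply: ez.
rewrite -ball_normE /= opprD addrA subrr sub0r normrN normrZ.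
rewrite ger0_norm ?invr_ge0 ?ltW// mulrC ltr_pdivrMr// distrC.
by rewrite mulrC.
Qed.

(** A set with an interior point [z] spans the whole space: any [x] is an affine combination of [z]
    and of a point close to [z] on the line to [x], with weights [1 - t^-1] and [t^-1]. *)
Lemma rel_interiorE : rel_interior (dom h) = (dom h)°.
Proof.
have [z iz] : (dom h)° !=set0 by case: h_smooth.
suff aff : affine_hull (dom h) = setT.
  apply/seteqP; split=> x; rewrite /rel_interior /= aff /within /=.
    by case=> _; apply: filterS => y /(_ I).
  by move=> ix; split; [exact: interior_subset|apply: filterS ix => y].
apply/seteqP; split=> // x _.
have /nbhs_ballP[e /= e0 ez] := iz.
have [->|xz] := eqVneq x z.
  exists 1%N, (fun=> 1), (fun=> z); rewrite !big_ord1 scale1r; split=> // _.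
  exact: interior_subset.
have N0 : 0 < `|x - z| by rewrite normr_gt0 subr_eq0.
pose t := e / (2 * `|x - z|).
have t0 : 0 < t by rewrite divr_gt0// mulr_gt0.
exists 2%N, (fun i : 'I_2 => if i == ord0 then t^-1 else 1 - t^-1),
  (fun i : 'I_2 => if i == ord0 then z + t *: (x - z) else z).
rewrite !big_ord_recl !big_ord0 /= !addr0; split=> //.
- by ring.
- move=> i; case: ifP => _; last exact: interior_subset.
  apply: ez; rewrite -ball_normE /= opprD addrA subrr sub0r normrN normrZ.
  rewrite (gtr0_norm t0).
  have -> : t * `|x - z| = e / 2 by rewrite /t; field; rewrite gt_eqF.
  by lra.
- by rewrite scalerDr scalerA mulVf ?gt_eqF//; apply/rowP=> i; rewrite !mxE; ring.
Qed.

Lemma bounded_near x : (dom h)° x ->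
  exists e, 0 < e /\ forall u : 'rV[R]_n, `|u| < e -> dom h (x + u) /\ f (x + u) <= f x + 1.
Proof.
move=> ix.
have C : \forall y \near x, f y <= f x + 1.
  have /differentiable_continuous c := smooth_interior ix.
  by have := cvgr_le (f x) c; apply; rewrite ltrDl.
have /nbhs_ballP[e /= e0 H] : nbhs x (dom h `&` [set y | f y <= f x + 1]).
  by apply: filterI.
exists e; split=> // u ue; apply: H.
by rewrite -ball_normE /= opprD addrA subrr sub0r normrN.
Qed.

(* If the slopes stayed above c, then the tangent at x + t (z - x), evaluated on
   a ball around z where h is bounded, would bound the gradients, against
   essential smoothness. *)
Lemma steep_at_boundary x z (c : R) : dom h x -> ~ (dom h)° x -> (dom h)° z ->
  ~ (forall t, 0 < t <= 1 -> c <= dot (grad h (x + t *: (z - x))) (z - x)).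
Proof.
move=> hx nix iz H.
pose u k : 'rV[R]_n := x + (k.+1%:R^-1 : R) *: (z - x).
have t01 k : 0 < (k.+1%:R^-1 : R) <= 1.
  by rewrite invr_gt0 ltr0Sn invf_le1// ler1n.
have iu k : (dom h)° (u k) by exact: segment_interior.
have ux : u @ \oo --> x.
  rewrite -[X in _ --> X]addr0 -(scale0r (z - x)).
  apply: cvgD; first exact: cvg_cst.
  by apply: cvgZr_tmp; exact: cvg_harmonic.
have [_ _ /(_ u x iu nix ux) blow] := h_smooth.
have [e [e0 be]] := bounded_near iz.
pose M := (1 + `|c| + `|dot (grad h z) (x - z)|) / (e / 2).
suff bound k : `|grad h (u k)| <= M.
  have [k _ /(_ k (leqnn _))] : \forall k \near \oo, M < `|grad h (u k)|.
    by move/cvgryPgt : blow; apply.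
  by move=> /=; rewrite ltNge bound.
have := iu k; rewrite /u; move: (t01 k).
move: (k.+1%:R^-1 : R) => {u t01 iu ux blow k} t tk iy.
have := H t tk; move: iy; have [y yE] : {y | y = x + t *: (z - x)} by exists (x + t *: (z - x)).
rewrite -yE => iy Hc.
have dy := smooth_interior iy.
apply: dot_bound_norm => // v.
  move=> ve; have [dv fv] := be _ ve.
  have := tangent_le iy dv.
  have -> : z + v - y = v + (1 - t) *: (z - x).
    by rewrite yE; apply/rowP=> i; rewrite !mxE; ring.
  move=> T1; rewrite (dotDr (grad h y) v ((1 - t) *: (z - x))) in T1.
  rewrite (dotZr (grad h y) (1 - t) (z - x)) in T1.
  have := tangent_le iz (interior_subset iy).
  have -> : y - z = (1 - t) *: (x - z) by rewrite yE; apply/rowP=> i; rewrite !mxE; ring.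
  move=> T2; rewrite (dotZr (grad h z) (1 - t) (x - z)) in T2.
exact: tangent_slope_le tk Hc T1 T2 fv.
Qed.

End ConvexFunctions.

Lemma lp_norm_ge (R : realType) (n : nat) (p : \bar R) (x : 'rV[R]_n) (i : 'I_n) :
  (1 <= p)%E -> `|x 0 i| <= lp_norm p x.
Proof.
case: p => [q| |] //= p1; last by apply: le_bigmax (fun i => `|x 0 i|) _.
have q0 : 0 < q by rewrite lee_fin in p1; lra.
rewrite -[leLHS]powRr1// -(divff (lt0r_neq0 q0)) powRrM.
apply: ge0_ler_powR; rewrite ?invr_ge0 ?nnegrE ?powR_ge0 ?(ltW q0)//.
  by apply: sumr_ge0 => j _; exact: powR_ge0.
by rewrite (bigD1 i)//= lerDl; apply: sumr_ge0 => j _; exact: powR_ge0.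
Qed.

Lemma lp_norm_ge0 (R : realType) (n : nat) (p : \bar R) (x : 'rV[R]_n) :
  0 <= lp_norm p x.
Proof.
by case: p => [q| |] /=; rewrite ?powR_ge0//; apply: bigmax_ge_id.
Qed.

(** * Probability vectors on the action set *)

Section Vec.
Context {R : realType} {A : finType}.
Implicit Types p q : A -> R.

Lemma sum_enum_val (F : A -> R) : \sum_(i < #|A|) F (enum_val i) = \sum_a F a.
Proof. by rewrite (reindex _ (onW_bij _ (@enum_val_bij A))). Qed.

Lemma expectE p q : expect p q = dot (vec q) (vec p).
Proof.
rewrite /expect -sum_enum_val; apply: eq_bigr => i _.
by rewrite !mxE mulrC.
Qed.

Lemma simplex_comb p q (t : R) : simplex p -> simplex q -> 0 <= t <= 1 ->
  simplex (fun a => p a + t * (q a - p a)).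
Proof.
move=> [p0 p1] [q0 q1] /andP[t0 t1]; split=> [a|].
  have := p0 a; have := q0 a; nra.
by rewrite big_split -big_distrr /= sumrB p1 q1 subrr mulr0 addr0.
Qed.

Lemma vec_comb p q (t : R) :
  vec (fun a => p a + t * (q a - p a)) = vec p + t *: (vec q - vec p).
Proof. by apply/rowP=> i; rewrite !mxE. Qed.

Lemma vec_simplex p : simplex p -> vsimplex (vec p).
Proof. by move=> sp; exists p. Qed.

(** Crude but uniform in the exponent, since every such norm dominates each coordinate. The square
    of this factor is the [|A|^2] of the step size and of the bound. *)
Lemma l1_le_lp p q (r : \bar R) : (1 <= r)%E ->
  \sum_a `|p a - q a| <= #|A|%:R * lp_norm r (vec p - vec q).
Proof.
move=> r1; rewrite -sum_enum_val.
apply: le_trans (_ : \sum_(i < #|A|) lp_norm r (vec p - vec q) <= _).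
  by apply: ler_sum => i _; have := lp_norm_ge (vec p - vec q) i r1; rewrite !mxE.
by rewrite sumr_const card_ord mulr_natl.
Qed.

Lemma simplex_le1 p a : simplex p -> p a <= 1.
Proof.
by move=> [p0 <-]; rewrite (bigD1 a)//= lerDl; apply: sumr_ge0.
Qed.

(* The differences sum to zero, so only their positive part, half of the
   l1 norm, is weighted. *)
Lemma expect_diff_le p q (f : A -> R) (c : R) : simplex p -> simplex q ->
  (forall a, 0 <= f a <= c) ->
  expect p f - expect q f <= c / 2 * \sum_a `|p a - q a|.
Proof.
move=> [_ p1] [_ q1] fc; rewrite -sumrB.
have -> : \sum_a (p a * f a - q a * f a) =
          \sum_a (p a - q a) * (f a - c / 2).
  under [RHS]eq_bigr do rewrite mulrBr.
  rewrite [RHS]sumrB -big_distrl /= [in X in _ - X]sumrB p1 q1 subrr mul0r subr0.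
  by apply: eq_bigr => a _; rewrite mulrBl.
rewrite big_distrr; apply: ler_sum => a _.
rewrite (le_trans (ler_norm _))// normrM mulrC ler_wpM2r// ler_norml.
by have := fc a; lra.
Qed.

End Vec.

(** Strong convexity is applied to both divergences of the three-point inequality, so the left side
    is quadratic in the step [l] and the right side linear, and one factor [l] cancels. [N1] and
    [N2] are the norms of the difference taken in either order, which avoids appealing to the
    symmetry of the norm. *)
Lemma step_length_aux (R : realFieldType) (lam n N1 N2 l d1 d2 eta c e e0 : R) :
  0 < lam -> 0 <= c -> 0 <= l -> 0 <= N1 -> 0 <= N2 -> l <= n * N1 -> l <= n * N2 ->
  lam / 2 * N2 ^+ 2 <= d1 -> lam / 2 * N1 ^+ 2 <= d2 -> 0 <= eta ->
  e - e0 <= c / 2 * l -> eta * (e0 - e) <= 0 - d1 - d2 ->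
  l <= eta * c * n ^+ 2 / (2 * lam).
Proof.
move=> lam0 c0 l0 N10 N20 L1 L2 D1 D2 eta0 E T.
rewrite ler_pdivlMr ?mulr_gt0//.
have [l1|l1] := leP l 0.
  have -> : l = 0 by apply/le_anti; rewrite l1.
  by rewrite mul0r; apply: mulr_ge0; [exact: mulr_ge0|exact: sqr_ge0].
rewrite -(ler_pM2l l1).
have S1 : l ^+ 2 <= n ^+ 2 * N1 ^+ 2 by rewrite -exprMn ler_sqr ?nnegrE// (le_trans l0).
have S2 : l ^+ 2 <= n ^+ 2 * N2 ^+ 2 by rewrite -exprMn ler_sqr ?nnegrE// (le_trans l0).
have B : lam / 2 * (N1 ^+ 2 + N2 ^+ 2) <= eta * (c / 2 * l).
  by apply: le_trans (ler_wpM2l eta0 E); lra.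
have := ler_wpM2l (sqr_ge0 n) B.
have := ler_wpM2l (ltW lam0) S1; have := ler_wpM2l (ltW lam0) S2.
by rewrite !expr2; lra.
Qed.

(** * The mirror descent step *)

Section MirrorDescent.
Context {R : realType} {A : finType} (h : 'rV[R]_#|A| -> \bar R).
Hypothesis hh : mirror_map h.
Variables (lambda : R) (r : \bar R).
Hypothesis lambda_gt0 : 0 < lambda.
Hypothesis r_ge1 : (1 <= r)%E.
Hypothesis h_strong : strongly_convex_on vsimplex lambda r h.
Implicit Types (p q : A -> R).

Local Notation f := (fine \o h).
Local Notation interior_policy p := ((dom h)° (vec p)).

Let hP := mirror_proper hh.
Let hC := mirror_strictly_convex hh.
Let hS := mirror_essentially_smooth hh.

Lemma simplex_dom p : simplex p -> dom h (vec p).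
Proof.
move=> sp; rewrite /dom /= ltey.
by have := mirror_finite hh (vec_simplex sp); rewrite fin_numE => /andP[].
Qed.

Lemma bregman_strong p q : simplex p -> simplex q -> interior_policy q ->
  lambda / 2 * lp_norm r (vec p - vec q) ^+ 2 <= action_div h p q.
Proof.
move=> sp sq iq; rewrite /action_div /bregman -/(dot _ _).
set N := lp_norm _ _ ^+ 2.
suff H : dot (grad h (vec q)) (vec p - vec q) <=
    f (vec p) - f (vec q) - lambda / 2 * N by move: H => /=; lra.
(* The factor [1 - t] in the strong convexity inequality becomes the slack of [diff_le] once divided
   by [t]. *)
apply: (@diff_le _ _ _ _ _ _ (lambda / 2 * N)).
  exact: smooth_interior.
move=> t /andP[t0 t1].
have -> : vec q + t *: (vec p - vec q) = t *: vec p + (1 - t) *: vec q.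
  by apply/rowP=> i; rewrite !mxE; ring.
have [dp dq] := (simplex_dom sp, simplex_dom sq).
have t01 : 0 <= t <= 1 by rewrite ltW.
have := h_strong (vec_simplex sp) (vec_simplex sq) t01.
rewrite (dom_fin hP dp) (dom_fin hP dq).
rewrite (dom_fin hP (convex_comb hP hC dp dq t01).1).
by rewrite -/N -EFinN -!EFinM -!EFinD lee_fin; nra.
Qed.

Lemma action_divxx p : action_div h p p = 0.
Proof. by rewrite /action_div /bregman !subrr -/(dot _ 0) dot0 subr0. Qed.

Lemma action_div_ge0 p q : simplex p -> simplex q -> interior_policy q ->
  0 <= action_div h p q.
Proof.
move=> sp sq iq; apply: le_trans (bregman_strong sp sq iq).
by rewrite mulr_ge0 ?exprn_ge0 ?lp_norm_ge0// divr_ge0// ltW.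
Qed.

Lemma action_div_eq0 p q : simplex p -> simplex q -> interior_policy q ->
  action_div h p q <= 0 -> p = q.
Proof.
move=> sp sq iq D0; apply/funext => a.
have N0 : lp_norm r (vec p - vec q) <= 0.
  have := le_trans (bregman_strong sp sq iq) D0.
  rewrite pmulr_rle0 ?divr_gt0//; move: (lp_norm _ _) => N; nra.
have := le_trans (lp_norm_ge (vec p - vec q) (enum_rank a) r_ge1) N0.
by rewrite !mxE enum_rankK normr_le0 subr_eq0 => /eqP.
Qed.

Section Step.
Variables (eta : R) (q p0 p : A -> R).
Hypothesis step : pmd_step h eta q p0 p.

Let slope p' := eta * dot (vec q) (vec p' - vec p)
  + dot (grad h (vec p0)) (vec p' - vec p).

(** Optimality against a point of the segment from [p] to [p'], with only the linear part of the
    objective moved to the left. No gradient at [p] appears: [p] is not yet known to be interior. *)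
Lemma pmd_slope p' (t : R) : simplex p' -> 0 <= t <= 1 ->
  t * slope p' <= f (vec p + t *: (vec p' - vec p)) - f (vec p).
Proof.
move=> sp' t01; have [sp opt] := step.
have := opt _ (simplex_comb sp sp' t01).
rewrite /pmd_objective /action_div /bregman vec_comb !expectE vec_comb -!/(dot _ _).
rewrite /slope; move: (vec p' - vec p) => v.
have -> : vec p + t *: v - vec p0 = (vec p - vec p0) + t *: v by rewrite addrAC.
move=> H.
rewrite (dotDr (vec q) (vec p) (t *: v)) (dotZr (vec q) t v) in H.
rewrite (dotDr (grad h (vec p0)) (vec p - vec p0) (t *: v)) in H.
rewrite (dotZr (grad h (vec p0)) t v) in H.
by move: H => /=; lra.
Qed.

(** If [p] were on the boundary, [pmd_slope] would bound the increments of [h] from [p] towards an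
    interior point [z] of the simplex from below. The tangent at a point of the open segment,
    evaluated at [p], turns this into a lower bound on the slopes along the segment, which
    [steep_at_boundary] excludes. *)
Lemma pmd_interior : interior_policy p.
Proof.
apply: contrapT => nip; have [sp _] := step.
have [_ [/[swap] -[z sz <-]]] := mirror_rint hh; rewrite (rel_interiorE hS) => iz.
suff steep (t : R) : 0 < t <= 1 ->
    slope z <= dot (grad h (vec p + t *: (vec z - vec p))) (vec z - vec p).
  exact: (steep_at_boundary hP hC hS (simplex_dom sp) nip iz steep).
move=> t01; have [t0 t1] := andP t01.
have iy := segment_interior hP hC (simplex_dom sp) iz t01.
have T := tangent_le hP hC hS iy (simplex_dom sp).
have t01' : 0 <= t <= 1 by rewrite (ltW t0) t1.
have T2 := pmd_slope sz t01'.
have E : vec p - (vec p + t *: (vec z - vec p)) = (- t) *: (vec z - vec p).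
  by apply/rowP=> i; rewrite !mxE; ring.
rewrite E in T.
move: (grad h (vec p + t *: (vec z - vec p))) T => g T.
rewrite (dotZr g (- t) (vec z - vec p)) in T.
rewrite -(ler_pM2l t0); apply: le_trans T2 _.
by move: T => /=; lra.
Qed.

(** Now that [p] is interior, dividing [pmd_slope] by [t] and letting [t] tend to 0 gives the
    first-order condition. *)
Lemma pmd_three_point p' : simplex p' ->
  eta * (expect p' q - expect p q) <=
  action_div h p' p0 - action_div h p' p - action_div h p p0.
Proof.
move=> sp'; have := pmd_interior => ip.
have : slope p' <= dot (grad h (vec p)) (vec p' - vec p).
  apply: diff_ge; first exact: smooth_interior.
  by move=> t /andP[t0 t1]; apply: pmd_slope => //; rewrite ltW.
rewrite /slope /action_div /bregman !expectE -!/(dot _ _).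
exact: dot_three_point.
Qed.

(** The three-point inequality at [p'] and the optimality of [p'] against [p] together make the
    divergence of [p'] from [p] nonpositive. This is what makes the policies functions of the
    history. *)
Lemma pmd_step_unique p' : pmd_step h eta q p0 p' -> p' = p.
Proof.
move=> [sp' opt']; have [sp _] := step.
apply: (action_div_eq0 sp' sp pmd_interior).
have := opt' _ sp; rewrite /pmd_objective.
have := pmd_three_point sp'; rewrite mulrBr.
by lra.
Qed.

Hypothesis sp0 : simplex p0.
Hypothesis ip0 : interior_policy p0.
Hypothesis eta_ge0 : 0 <= eta.
Variable c : R.
Hypothesis c_ge0 : 0 <= c.
Hypothesis q_itv : forall a, 0 <= q a <= c.

(** The competitor is [p0] itself: its own divergence vanishes, and the divergences between [p] and
    [p0] in both orders remain. *)
Lemma pmd_move : \sum_a `|p a - p0 a| <= eta * c * #|A|%:R ^+ 2 / (2 * lambda).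
Proof.
have [sp _] := step; have T := pmd_three_point sp0.
have B1 := bregman_strong sp0 sp pmd_interior.
have B2 := bregman_strong sp sp0 ip0.
have E := expect_diff_le sp sp0 q_itv.
have L1 := l1_le_lp p p0 r_ge1.
have L2 := l1_le_lp p0 p r_ge1.
rewrite (eq_bigr (fun a => `|p a - p0 a|)) in L2; last by move=> a _; rewrite distrC.
have l0 : 0 <= \sum_a `|p a - p0 a| by apply: sumr_ge0.
rewrite action_divxx in T.
exact: (step_length_aux lambda_gt0 c_ge0 l0 (lp_norm_ge0 _ _) (lp_norm_ge0 _ _)
  L1 L2 B1 B2 eta_ge0 E T).
Qed.

End Step.

End MirrorDescent.

(** * Discounted occupancies *)

Lemma cvg_finsum (R : realType) (X : finType) (u : X -> nat -> R) (l : X -> R) :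
  (forall x, u x @ \oo --> l x) ->
  (fun n => \sum_x u x n) @ \oo --> \sum_x l x.
Proof.
move=> H; suff K (r : seq X) : (fun n => \sum_(x <- r) u x n) @ \oo --> \sum_(x <- r) l x.
  exact: K.
elim: r => [|x r IH].
  by under eq_fun do rewrite big_nil; rewrite big_nil; exact: cvg_cst.
by under eq_fun do rewrite big_cons; rewrite big_cons; apply: cvgD.
Qed.

Section Occupancy.
Context {R : realType} {S A : finType} (M : @mdp R S A).
Local Notation gamma := (discount M).
Implicit Types (pi : S -> A -> R) (mu : S -> R) (f : S -> R).

Lemma gamma_ge0 : 0 <= gamma. Proof. by case/andP: (discount_itv M). Qed.

Lemma onem_gamma_gt0 : 0 < 1 - gamma.
Proof. by case/andP: (discount_itv M) => _; rewrite subr_gt0. Qed.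

Lemma geometric_le n : \sum_(t < n) gamma ^+ t <= (1 - gamma)^-1.
Proof.
have g1 := onem_gamma_gt0; have g0 := gamma_ge0.
rewrite -[leRHS]mul1r ler_pdivlMr// mulrC.
have -> : (1 - gamma) * \sum_(t < n) gamma ^+ t = 1 - gamma ^+ n.
  by rewrite -[1 - gamma]opprB mulNr -subrX1 opprB.
by rewrite lerBlDr lerDl exprn_ge0.
Qed.

Lemma state_trans_simplex pi s : policies pi -> simplex (state_trans M pi s).
Proof.
move=> hpi; split=> [s'|].
  apply: sumr_ge0 => a _; apply: mulr_ge0; first by case: (hpi s).
  by case: (trans_simplex M s a).
rewrite exchange_big /= -[RHS](proj2 (hpi s)); apply: eq_bigr => a _.
by rewrite -mulr_sumr /= (proj2 (trans_simplex M s a)) mulr1.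
Qed.

Section Steps.
Variable T : S -> S -> R.
Hypothesis hT : forall s, simplex (T s).

Lemma steps_simplex t s : simplex (steps T t s).
Proof.
elim: t s => [|t IH] s.
  split=> [s'|]; first exact: ler0n.
  rewrite /= (bigD1 s)//= eqxx big1 ?addr0// => i /negPf; rewrite eq_sym => ->.
  by [].
split=> [s'|] /=.
  apply: sumr_ge0 => z _; apply: mulr_ge0; first by case: (hT s).
  by case: (IH z).
rewrite exchange_big /= -[RHS](proj2 (hT s)); apply: eq_bigr => z _.
by rewrite -mulr_sumr /= (proj2 (IH z)) mulr1.
Qed.

Lemma stepsSr t s s' : steps T t.+1 s s' = \sum_z steps T t s z * T z s'.
Proof.
elim: t s => [|t IH] s /=.
  rewrite (bigD1 s')//= eqxx mulr1 big1 ?addr0 => [|z /negPf]; last first.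
    by move=> ->; rewrite mulr0.
  rewrite (bigD1 s)//= eqxx mul1r big1 ?addr0// => z /negPf.
  by rewrite eq_sym => ->; rewrite mul0r.
under eq_bigr => z _ do rewrite -/(steps T t.+1 z s') IH mulr_sumr.
under [in RHS]eq_bigr do rewrite mulr_suml.
rewrite exchange_big /=; apply: eq_bigr => z _; apply: eq_bigr => u _.
by rewrite /= mulrA.
Qed.

End Steps.

Definition discounted_steps pi s0 (n : nat) s : R :=
  \sum_(t < n) gamma ^+ t * steps (state_trans M pi) t s0 s.

Definition occ pi s0 s : R := limn (fun n => discounted_steps pi s0 n s).

Section Policy.
Variable pi : S -> A -> R.
Hypothesis hpi : policies pi.
Local Notation T := (state_trans M pi).
Let hT s := state_trans_simplex s hpi.

Lemma discounted_steps_cvg s0 s :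
  (fun n => discounted_steps pi s0 n s) @ \oo --> occ pi s0 s.
Proof.
apply: nondecreasing_is_cvgn.
  apply/nondecreasing_seqP => n; rewrite /discounted_steps big_ord_recr /= lerDl.
  by rewrite mulr_ge0 ?exprn_ge0 ?gamma_ge0//; case: (steps_simplex hT n s0).
exists ((1 - gamma)^-1) => _ [n _ <-].
apply: le_trans (geometric_le n).
apply: ler_sum => t _; rewrite ler_piMr ?exprn_ge0 ?gamma_ge0//.
exact: simplex_le1 (steps_simplex hT t s0).
Qed.

Lemma discounted_steps_recl s0 n s : discounted_steps pi s0 n.+1 s =
  (s0 == s)%:R + gamma * \sum_z discounted_steps pi s0 n z * T z s.
Proof.
rewrite /discounted_steps big_ord_recl expr0 mul1r; congr (_ + _).
under [in RHS]eq_bigr do rewrite mulr_suml.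
rewrite exchange_big mulr_sumr; apply: eq_bigr => t _.
rewrite lift0 stepsSr exprS /= -mulrA; congr (_ * _).
by rewrite mulr_sumr; apply: eq_bigr => z _; rewrite mulrA.
Qed.

Lemma occ_flow s0 s :
  occ pi s0 s = (s0 == s)%:R + gamma * \sum_z occ pi s0 z * T z s.
Proof.
have C1 : (fun n => discounted_steps pi s0 n.+1 s) @ \oo --> occ pi s0 s.
  have := @discounted_steps_cvg s0 s.
  by rewrite -(cvg_shiftS (fun n => discounted_steps pi s0 n s)).
have C2 : (fun n => discounted_steps pi s0 n.+1 s) @ \oo -->
    (s0 == s)%:R + gamma * \sum_z occ pi s0 z * T z s.
  under eq_fun do rewrite discounted_steps_recl.
  apply: cvgD; first exact: cvg_cst.
  apply: cvgMl_tmp; apply: cvg_finsum => z.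
  by apply: cvgMr_tmp; exact: discounted_steps_cvg.
exact: (cvg_unique _ C1 C2).
Qed.

Lemma occ_ge0 s0 s : 0 <= occ pi s0 s.
Proof.
apply: limr_ge; first by apply/cvg_ex; exists (occ pi s0 s); exact: discounted_steps_cvg.
near=> n; apply: sumr_ge0 => t _; rewrite mulr_ge0 ?exprn_ge0 ?gamma_ge0//.
by case: (steps_simplex hT t s0).
Unshelve. all: by end_near. Qed.

Lemma discounted_steps_expect_cvg s0 f :
  (fun n => \sum_(t < n) gamma ^+ t * expect (steps T t s0) f) @ \oo -->
  expect (occ pi s0) f.
Proof.
have -> : (fun n => \sum_(t < n) gamma ^+ t * expect (steps T t s0) f) =
          (fun n => \sum_s discounted_steps pi s0 n s * f s).
  apply/funext => n; under [RHS]eq_bigr do rewrite mulr_suml.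
  rewrite exchange_big; apply: eq_bigr => t _; rewrite /expect mulr_sumr.
  by apply: eq_bigr => s _; rewrite mulrA.
by apply: cvg_finsum => s; apply: cvgMr_tmp; exact: discounted_steps_cvg.
Qed.

Variable mu : S -> R.

Definition visit (s : S) : R := \sum_s0 mu s0 * occ pi s0 s.

Lemma visit_flow s : visit s = mu s + gamma * \sum_z visit z * T z s.
Proof.
rewrite /visit; under eq_bigr do rewrite occ_flow mulrDr.
rewrite big_split /=; congr (_ + _).
  rewrite (bigD1 s)//= eqxx mulr1 big1 ?addr0// => z /negPf ->.
  by rewrite mulr0.
under [in RHS]eq_bigr do rewrite mulr_suml.
rewrite exchange_big mulr_sumr; apply: eq_bigr => s0 _.
rewrite mulrCA; congr (_ * _); rewrite mulr_sumr.
by apply: eq_bigr => z _; rewrite mulrA.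
Qed.

(** The flow equation paired with [f]: [f = 1] gives the total mass of [visit], an approximate value
    function gives the performance difference. *)
Lemma visit_expect f :
  expect mu f = \sum_s visit s * (f s - gamma * expect (T s) f).
Proof.
under eq_bigr do rewrite mulrBr.
rewrite sumrB; apply/eqP; rewrite -subr_eq opprK; apply/eqP.
rewrite /expect; under [in RHS]eq_bigr do rewrite visit_flow mulrDl.
rewrite big_split /=; congr (_ + _).
under eq_bigr do rewrite mulrCA mulr_sumr.
rewrite -mulr_sumr exchange_big /=.
under [in RHS]eq_bigr do rewrite -mulrA.
rewrite -[RHS]mulr_sumr; congr (_ * _); apply: eq_bigr => s _ /=.
by rewrite mulr_suml; apply: eq_bigr => z _; rewrite mulrA.
Qed.

Hypothesis hmu : simplex mu.

Lemma visit_ge0 s : 0 <= visit s.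
Proof. by apply: sumr_ge0 => z _; rewrite mulr_ge0 ?occ_ge0//; case: hmu. Qed.

Lemma visit_sum : \sum_s visit s = (1 - gamma)^-1.
Proof.
have := visit_expect (fun=> 1); rewrite /expect.
under eq_bigr do rewrite mulr1.
rewrite (proj2 hmu).
under eq_bigr => s _.
  under eq_bigr do rewrite mulr1.
  rewrite (proj2 (hT s)) mulr1; over.
rewrite -mulr_suml /= => H; apply: (mulIf (lt0r_neq0 onem_gamma_gt0)).
by rewrite -H mulVf// lt0r_neq0// onem_gamma_gt0.
Qed.

Definition visit_sa (s : S) (a : A) : R := visit s * pi s a.

Lemma visit_sa_ge0 s a : 0 <= visit_sa s a.
Proof. by rewrite mulr_ge0 ?visit_ge0//; case: (hpi s). Qed.

Lemma visit_sa_sum : \sum_s \sum_a visit_sa s a = (1 - gamma)^-1.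
Proof.
rewrite -visit_sum; apply: eq_bigr => s _.
by rewrite -mulr_sumr /= (proj2 (hpi s)) mulr1.
Qed.

Definition policy_value (s0 : S) : R :=
  expect (occ pi s0) (fun s => expect (pi s) (reward M s)).

Lemma expect_state_trans s f : expect (T s) f =
  expect (pi s) (fun a => expect (trans M s a) f).
Proof.
rewrite /expect /state_trans; under eq_bigr do rewrite mulr_suml.
rewrite exchange_big /=; apply: eq_bigr => a _; rewrite mulr_sumr.
by apply: eq_bigr => z _; rewrite mulrA.
Qed.

Definition backup f (s : S) (a : A) : R :=
  reward M s a + gamma * expect (trans M s a) f.

(** Here [f] may be the value of no policy at all; this lets [value_gap] pass through the state
    values read off [Q]. *)
Lemma performance_difference f : expect mu policy_value - expect mu f =
  \sum_s visit s * (expect (pi s) (backup f s) - f s).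
Proof.
rewrite [X in _ - X]visit_expect.
have -> : expect mu policy_value = \sum_s visit s * expect (pi s) (reward M s).
  rewrite /expect /policy_value /visit.
  under [RHS]eq_bigr do rewrite mulr_suml.
  rewrite exchange_big; apply: eq_bigr => s0 _; rewrite mulr_sumr.
  by apply: eq_bigr => s _; rewrite mulrA.
rewrite -sumrB; apply: eq_bigr => s _; rewrite -mulrBr expect_state_trans.
congr (_ * _).
have -> : expect (pi s) (backup f s) = expect (pi s) (reward M s) +
    gamma * expect (pi s) (fun a => expect (trans M s a) f); last by ring.
rewrite {2}/expect mulr_sumr -big_split; apply: eq_bigr => a _ /=.
by rewrite mulrDr [in LHS]mulrCA.
Qed.

End Policy.

(** * Lipschitz dependence of the occupancies on the policy *)

Section Lipschitz.
Variables (pi pi' : S -> A -> R) (mu : S -> R) (delta : R).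
Hypotheses (hpi : policies pi) (hpi' : policies pi') (hmu : simplex mu).
Hypothesis near : forall s, \sum_a `|pi' s a - pi s a| <= delta.
Local Notation q := ((1 - gamma)^-1).

Lemma state_trans_dist s :
  \sum_s' `|state_trans M pi' s s' - state_trans M pi s s'| <= delta.
Proof.
apply: le_trans (near s).
apply: (@le_trans _ _ (\sum_s' \sum_a `|pi' s a - pi s a| * trans M s a s')).
  apply: ler_sum => s' _; rewrite /state_trans -sumrB.
  apply: le_trans (ler_norm_sum _ _ _) _; apply: ler_sum => a _.
  by rewrite -mulrBl normrM [`|trans _ _ _ _|]ger0_norm//; case: (trans_simplex M s a).
rewrite exchange_big /=; apply: ler_sum => a _.
by rewrite -mulr_sumr /= (proj2 (trans_simplex M s a)) mulr1.
Qed.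

(** Subtracting the two flow equations bounds the distance by [gamma] times the sum of itself and of
    the change of the kernel, weighted by the mass [q] of [visit pi mu]. As [gamma < 1], this can be
    solved for the distance. *)
Lemma visit_dist :
  \sum_s `|visit pi' mu s - visit pi mu s| <= gamma * q ^+ 2 * delta.
Proof.
set D := \sum_s _.
have q0 : 0 < 1 - gamma := onem_gamma_gt0.
have g0 := gamma_ge0.
suff H : D <= gamma * (D + q * delta).
  have : D * (1 - gamma) <= gamma * (q * delta) by move: H; lra.
  by rewrite -ler_pdivlMr// => /le_trans; apply; rewrite le_eqVlt; apply/orP; left;
    apply/eqP; field; rewrite gt_eqF.
have -> : gamma * (D + q * delta) =
    gamma * (\sum_z (`|visit pi' mu z - visit pi mu z| + visit pi mu z * delta)).
  by rewrite big_split /= -mulr_suml /= visit_sum.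
apply: (@le_trans _ _ (gamma * \sum_s \sum_z
   (`|visit pi' mu z - visit pi mu z| * state_trans M pi' z s +
    visit pi mu z * `|state_trans M pi' z s - state_trans M pi z s|))).
  rewrite mulr_sumr; apply: ler_sum => s _.
  rewrite (visit_flow hpi') (visit_flow hpi).
  rewrite opprD addrACA subrr add0r -mulrBr normrM ger0_norm// ler_wpM2l//.
  rewrite -sumrB; apply: le_trans (ler_norm_sum _ _ _) _; apply: ler_sum => z _.
  have -> : visit pi' mu z * state_trans M pi' z s - visit pi mu z * state_trans M pi z s
    = (visit pi' mu z - visit pi mu z) * state_trans M pi' z s +
      visit pi mu z * (state_trans M pi' z s - state_trans M pi z s) by ring.
  apply: le_trans (ler_normD _ _) _; rewrite !normrM.
  rewrite [`|visit pi mu z|]ger0_norm ?visit_ge0//.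
  by rewrite [`|state_trans _ _ _ _|]ger0_norm//; case: (state_trans_simplex z hpi').
rewrite ler_wpM2l// exchange_big; apply: ler_sum => z _.
rewrite big_split -!mulr_sumr /= (proj2 (state_trans_simplex z hpi')) mulr1.
by rewrite lerD2l ler_wpM2l ?visit_ge0// state_trans_dist.
Qed.

(** The change of the state occupancy plus the mass [q] times the change of the policy;
    [gamma * q ^+ 2 + q = q ^+ 2] merges the two. *)
Lemma visit_sa_dist :
  \sum_s \sum_a `|visit_sa pi' mu s a - visit_sa pi mu s a| <= q ^+ 2 * delta.
Proof.
apply: (@le_trans _ _ (\sum_s (`|visit pi' mu s - visit pi mu s| + visit pi mu s * delta))).
  apply: ler_sum => s _.
  apply: (@le_trans _ _ (\sum_a (`|visit pi' mu s - visit pi mu s| * pi' s a +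
      visit pi mu s * `|pi' s a - pi s a|))).
    apply: ler_sum => a _; rewrite /visit_sa.
    have -> : visit pi' mu s * pi' s a - visit pi mu s * pi s a =
      (visit pi' mu s - visit pi mu s) * pi' s a + visit pi mu s * (pi' s a - pi s a)
      by ring.
    apply: le_trans (ler_normD _ _) _; rewrite !normrM.
    rewrite [`|visit pi mu s|]ger0_norm ?visit_ge0//.
    by rewrite [`|pi' s a|]ger0_norm//; case: (hpi' s).
  rewrite big_split -!mulr_sumr /= (proj2 (hpi' s)) mulr1.
  by rewrite lerD2l ler_wpM2l ?visit_ge0// near.
rewrite big_split /= -mulr_suml /= visit_sum//.
have := visit_dist; have q0 : 0 < 1 - gamma := onem_gamma_gt0.
have -> : q ^+ 2 * delta = gamma * q ^+ 2 * delta + q * delta.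
  by field; rewrite gt_eqF.
by lra.
Qed.

End Lipschitz.

(* Telescoping [V* - V^pi0] through the value [V] of [pi1] read off [Q]. *)
Lemma value_gap (pistar pi0 pi1 Q : S -> A -> R) (mu : S -> R) :
  policies pistar -> policies pi0 ->
  let V s := expect (pi1 s) (Q s) in
  let res s a := backup V s a - Q s a in
  expect mu (policy_value pistar) - expect mu (policy_value pi0) =
  \sum_s \sum_a (visit_sa pistar mu s a - visit_sa pi0 mu s a) * res s a
  + \sum_s visit pistar mu s * (expect (pistar s) (Q s) - expect (pi1 s) (Q s))
  + \sum_s visit pi0 mu s * (expect (pi1 s) (Q s) - expect (pi0 s) (Q s)).
Proof.
move=> hs h0 V res.
have E1 := performance_difference hs mu V.
have E0 := performance_difference h0 mu V.
have -> : expect mu (policy_value pistar) - expect mu (policy_value pi0) =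
  (expect mu (policy_value pistar) - expect mu V) -
  (expect mu (policy_value pi0) - expect mu V) by ring.
rewrite E1 E0 -sumrB -!big_split; apply: eq_bigr => s _ /=.
have B (pi : S -> A -> R) : expect (pi s) (backup V s) =
    \sum_a pi s a * res s a + expect (pi s) (Q s).
  by rewrite /expect -big_split; apply: eq_bigr => a _ /=; rewrite /res; ring.
rewrite !B.
under [in RHS]eq_bigr do rewrite /visit_sa mulrBl -!mulrA.
rewrite sumrB -!mulr_sumr /= /V; ring.
Qed.

End Occupancy.

(** * Expectations over finite histories *)

Lemma integral_finite (R : realType) (d : measure_display)
    (Omega : measurableType d) (P : probability Omega R) (Z : finType)
    (g : Omega -> Z) (f : Z -> R) :
  (forall z, measurable (g @^-1` [set z])) ->
  (\int[P]_w (f (g w))%:E = \sum_z (f z)%:E * P (g @^-1` [set z]))%E.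
Proof.
move=> mg; transitivity
  (\int[P]_w \sum_z ((f z)%:E * (\1_(g @^-1` [set z]) w)%:E))%E.
  apply: eq_integral => w _; rewrite (bigD1 (g w))//= big1 ?adde0 => [|z zw].
    by rewrite indicE mem_set// mule1.
  by rewrite indicE memNset ?mule0// => /= E; rewrite -E eqxx in zw.
rewrite integral_sum// => [|z].
  apply: eq_bigr => z _; rewrite integralZl//; last exact: integrable_indic.
  by rewrite integral_indic// setIT.
by apply: integrableZl => //; exact: integrable_indic.
Qed.

Section Trajectory.
Context {R : realType} {S A : finType} (M : @mdp R S A).
Context {d : measure_display} {Omega : measurableType d}.
Variables (X : nat -> Omega -> S) (Y : nat -> Omega -> A).
Variables (P : probability Omega R) (pi : S -> A -> R) (s0 : S).
Hypothesis hpi : policies pi.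

(** Nested pairs make every [hist n] a finite type and turn the restriction to the past into the
    first projection. *)
Fixpoint hist (n : nat) : finType :=
  if n is n'.+1 then (hist n' * (A * S))%type : finType else S.

Definition hist_last (n : nat) : hist n -> S :=
  match n with 0 => fun z => z | n'.+1 => fun z => z.2.2 end.

Fixpoint hist_prob (n : nat) : hist n -> R :=
  match n with
  | 0 => fun z => (z == s0)%:R
  | n'.+1 => fun z => hist_prob z.1 *
      (pi (hist_last z.1) z.2.1 * trans M (hist_last z.1) z.2.1 z.2.2)
  end.

Fixpoint history (n : nat) (w : Omega) : hist n :=
  match n with 0 => X 0 w | n'.+1 => (history n' w, (Y n' w, X n'.+1 w)) end.

Lemma hist_last_history n w : hist_last (history n w) = X n w.
Proof. by case: n. Qed.

Lemma hist_prob_ge0 n (z : hist n) : 0 <= hist_prob z.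
Proof.
elim: n z => [|n IH] z /=; first exact: ler0n.
rewrite mulr_ge0//; apply: mulr_ge0; first by case: (hpi (hist_last z.1)).
by case: (trans_simplex M (hist_last z.1) z.2.1).
Qed.

Fixpoint hist_of (x : nat -> S) (y : nat -> A) (n : nat) : hist n :=
  match n with 0 => x 0 | n'.+1 => (hist_of x y n', (y n', x n'.+1)) end.

Lemma hist_last_of x y n : hist_last (hist_of x y n) = x n.
Proof. by case: n. Qed.

Lemma hist_prob_of x y n : hist_prob (hist_of x y n) = (x 0 == s0)%:R *
  \prod_(t < n) (pi (x t) (y t) * trans M (x t) (y t) (x t.+1)).
Proof.
elim: n => [|n IH]; first by rewrite big_ord0 mulr1.
by rewrite big_ord_recr mulrA -IH /= hist_last_of.
Qed.

Lemma traj_event_hist n x y w :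
  traj_event X Y n x y w <-> history n w = hist_of x y n.
Proof.
elim: n => [|n IH] /=.
  by split=> [[/(_ 0 (leqnn _))]//|X0]; split=> // -[].
split=> [[HX HY]|[/IH[HX HY] Yn Xn]].
  rewrite HX// HY//; congr (_, _); apply/IH.
  by split=> t tn; [apply: HX|apply: HY]; exact: leqW.
split=> t; rewrite ?ltnS leq_eqVlt => /orP[/eqP ->//|tn]; [exact: HX|exact: HY].
Qed.

Lemma eq_hist_of x x' y y' n : (forall t, (t <= n)%N -> x t = x' t) ->
  (forall t, (t < n)%N -> y t = y' t) -> hist_of x y n = hist_of x' y' n.
Proof.
elim: n => [|n IH] xx yy /=; first exact: xx.
by rewrite xx// yy// IH// => t tn; [apply: xx|apply: yy]; exact: leqW.
Qed.

Lemma hist_of_surj n (z : hist n) :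
  exists (x : nat -> S) (y : nat -> A), hist_of x y n = z.
Proof.
have /card_gt0P[a0 _] := action_nonempty M.
elim: n z => [|n IH] z; first by exists (fun=> z), (fun=> a0).
have [x [y xyz]] := IH z.1.
exists (fun t => if t == n.+1 then z.2.2 else x t),
  (fun t => if t == n then z.2.1 else y t).
rewrite /= !eqxx (_ : hist_of _ _ _ = z.1); first by case: (z) => ? [].
rewrite -xyz; apply: eq_hist_of => t tn; first by rewrite ltn_eqF.
by rewrite ltn_eqF.
Qed.

(** Measurability with respect to the first [n] steps: as there are finitely many histories, it
    amounts to factoring through [history n]. *)
Definition adapted {T : Type} (n : nat) (f : Omega -> T) : Prop :=
  forall w w', history n w = history n w' -> f w = f w'.

Lemma history_le m n w w' : (m <= n)%N ->
  history n w = history n w' -> history m w = history m w'.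
Proof.
elim: n => [|n IH]; first by rewrite leqn0 => /eqP ->.
by rewrite leq_eqVlt => /orP[/eqP ->//|mn] /= [/(IH mn)].
Qed.

Lemma adapted_le {T : Type} m n (f : Omega -> T) : (m <= n)%N -> adapted m f -> adapted n f.
Proof. by move=> mn af w w' /(history_le mn)/af. Qed.

Lemma adapted_X m n : (m <= n)%N -> adapted n (X m).
Proof.
move=> mn w w' /(history_le mn) E.
by rewrite -!hist_last_history E.
Qed.

Lemma adapted_Y m n : (m < n)%N -> adapted n (Y m).
Proof. by move=> mn w w' /(history_le mn) /= []. Qed.

Section Expectation.
Variable N : nat.
Hypothesis traj : is_trajectory M X Y P pi s0 N.

Lemma history_measurable n (z : hist n) : (n <= N)%N ->
  measurable (history n @^-1` [set z]).
Proof.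
case: traj => mX mY _; elim: n z => [|n IH] z nN; first exact: mX.
have -> : history n.+1 @^-1` [set z] = history n @^-1` [set z.1] `&`
    (Y n @^-1` [set z.2.1] `&` X n.+1 @^-1` [set z.2.2]).
  apply/seteqP; split=> w /=; first by move=> <-.
  by move=> [-> [-> ->]]; case: (z) => ? [].
apply: measurableI; first by apply: IH; exact: ltnW.
by apply: measurableI; [exact: mY|exact: mX].
Qed.

Lemma history_prob (z : hist N) : P (history N @^-1` [set z]) = (hist_prob z)%:E.
Proof.
have [x [y <-]] := hist_of_surj z.
rewrite hist_prob_of; case: traj => _ _ <-; congr (P _).
by apply/seteqP; split=> w /traj_event_hist.
Qed.

Lemma hist_prob_succ n (z : hist n) :
  \sum_(u : A * S) hist_prob (n := n.+1) (z, u) = hist_prob z.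
Proof.
rewrite /= -mulr_sumr -[RHS]mulr1; congr (_ * _).
rewrite -(pair_big xpredT xpredT (fun a s => pi (hist_last z) a * trans M (hist_last z) a s)) /=.
rewrite -(proj2 (hpi (hist_last z))); apply: eq_bigr => a _.
by rewrite -mulr_sumr (proj2 (trans_simplex M _ _)) mulr1.
Qed.

(** Only events of the full length [N] have a prescribed probability. A history of positive
    probability is extended by positive transitions to that length, and an event of positive measure
    is not empty. *)
Lemma history_realized n (z : hist n) : (n <= N)%N -> 0 < hist_prob z ->
  exists w, history n w = z.
Proof.
move=> nN; have [k Nk] : exists k, N = (n + k)%N by exists (N - n)%N; rewrite subnKC.
elim: k n z {nN} Nk => [|k IH] n z Nk z0.
  rewrite addn0 in Nk; move: z z0; rewrite -Nk => z z0.
  apply: contrapT => H; have := history_prob z.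
  rewrite (_ : history N @^-1` [set z] = set0) ?measure0.
    by move=> /eqP; rewrite lt_eqF.
  by apply/seteqP; split=> w //= zw; apply: H; exists w.
have [u u0] : exists u, 0 < hist_prob (n := n.+1) (z, u).
  apply/existsP; apply: contraTT z0 => /existsPn H.
  rewrite -hist_prob_succ -leNgt; apply: sumr_le0 => u _.
  by rewrite leNgt H.
have [|w /= Hw] := IH n.+1 (z, u) _ u0; first by rewrite addSnnS.
by exists w; case: Hw.
Qed.

Lemma omega_inhabited : exists w : Omega, True.
Proof.
apply: contrapT => H; have : P setT = 0%E.
  by rewrite (_ : setT = set0) ?measure0//; apply/seteqP; split=> w // _; apply: H; exists w.
by rewrite probability_setT => /eqP; rewrite onee_eq0.
Qed.

(** Chooses a sample point for each history, so that an adapted function on [Omega] becomes a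
    function on a finite type. A history that never occurs gets an arbitrary point, which is
    harmless up to length [N], where it has probability 0. *)
Definition realization n (z : hist n) : Omega :=
  if pselect (exists w, history n w = z) is left h then sval (cid h)
  else sval (cid omega_inhabited).

Lemma realizationK n w : history n (realization (history n w)) = history n w.
Proof.
rewrite /realization; case: pselect => [h|]; first exact: svalP (cid h).
by case; exists w.
Qed.

Lemma realizationE n (z : hist n) : (n <= N)%N -> 0 < hist_prob z ->
  history n (realization z) = z.
Proof. by move=> nN /(history_realized nN) [w <-]; exact: realizationK. Qed.

Definition hist_expect (n : nat) (f : Omega -> R) : R :=
  \sum_z hist_prob (n := n) z * f (realization z).

(** Integrates out the last step. [F] takes the new action and state as separate arguments, so that
    the rest of it depends on the past alone. Histories of probability 0 are treated apart because
    their realization may be wrong. *)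
Lemma hist_expect_markov n (F : Omega -> A -> S -> R) : (n < N)%N ->
  (forall a s, adapted n (fun w => F w a s)) ->
  hist_expect n.+1 (fun w => F w (Y n w) (X n.+1 w)) =
  hist_expect n (fun w => expect (pi (X n w)) (fun a =>
    expect (trans M (X n w) a) (F w a))).
Proof.
move=> nN aF; rewrite /hist_expect.
pose G (z : hist n) (u : A * S) := hist_prob (n := n.+1) (z, u) *
  F (realization (n := n.+1) (z, u)) (Y n (realization (n := n.+1) (z, u)))
    (X n.+1 (realization (n := n.+1) (z, u))).
transitivity (\sum_z \sum_u G z u).
  by rewrite pair_big; apply: eq_bigr => -[].
apply: eq_bigr => z _.
have [z0|] := boolP (hist_prob z == 0).
  rewrite (eqP z0) mul0r big1// => u _.
  by rewrite /G /= (eqP z0) !mul0r.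
rewrite neq_lt ltNge hist_prob_ge0 /= => z0.
have rz := realizationE (ltnW nN) z0.
have Xz : X n (realization z) = hist_last z by rewrite -hist_last_history rz.
rewrite Xz /expect mulr_sumr.
transitivity (\sum_a \sum_s G z (a, s)).
  by rewrite pair_big; apply: eq_bigr => -[].
apply: eq_bigr => a _; rewrite !mulr_sumr; apply: eq_bigr => s _.
have [u0|] := boolP (hist_prob (n := n.+1) (z, (a, s)) == 0).
  rewrite /G (eqP u0) mul0r; move: u0; rewrite /= => /eqP.
  by rewrite !mulrA => ->; rewrite mul0r.
rewrite neq_lt ltNge hist_prob_ge0 => u0.
have := realizationE (n := n.+1) nN u0.
rewrite /G; set w := realization _ => -[Hw HY HX].
rewrite -/w HY HX (aF a s w (realization z)); last by rewrite Hw rz.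
by rewrite /= !mulrA.
Qed.

Lemma hist_expect_succ n f : (n < N)%N -> adapted n f ->
  hist_expect n.+1 f = hist_expect n f.
Proof.
move=> nN af; rewrite (@hist_expect_markov n (fun w _ _ => f w))//.
apply: eq_bigr => z _; congr (_ * _); rewrite /expect.
under eq_bigr do rewrite -mulr_suml (proj2 (trans_simplex M _ _)) mul1r.
by rewrite -mulr_suml (proj2 (hpi _)) mul1r.
Qed.

(* The expectation of f when f is adapted N; for other f, only an algebraic
   device: a linear and monotone functional. *)
Definition traj_expect (f : Omega -> R) : R := hist_expect N f.

Lemma traj_expect_hist n f : (n <= N)%N -> adapted n f -> traj_expect f = hist_expect n f.
Proof.
move=> nN af; rewrite /traj_expect; move: (leqnn N); rewrite -{1 3}(subnKC nN).
elim: (N - n)%N => [|m IH]; first by rewrite addn0.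
rewrite addnS => mN; rewrite hist_expect_succ ?IH//; first exact: ltnW.
by apply: adapted_le af; exact: leq_addr.
Qed.

Lemma traj_expect_markov n (F : Omega -> A -> S -> R) : (n < N)%N ->
  (forall a s, adapted n (fun w => F w a s)) ->
  traj_expect (fun w => F w (Y n w) (X n.+1 w)) =
  traj_expect (fun w => expect (pi (X n w)) (fun a => expect (trans M (X n w) a) (F w a))).
Proof.
move=> nN aF; rewrite (@traj_expect_hist n.+1)//; last first.
  move=> w w' /= [Hw -> ->].
  exact: aF.
rewrite hist_expect_markov// -(@traj_expect_hist n)//; first exact: ltnW.
move=> w w' Hw; rewrite (adapted_X (leqnn n) Hw).
by apply: eq_bigr => a _; congr (_ * _); apply: eq_bigr => s _; rewrite (aF a s w w').
Qed.

Lemma eq_traj_expect f g : f =1 g -> traj_expect f = traj_expect g.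
Proof. by move=> fg; apply: eq_bigr => z _; rewrite fg. Qed.

Lemma traj_expect_D f g : traj_expect (fun w => f w + g w) = traj_expect f + traj_expect g.
Proof. by rewrite -big_split; apply: eq_bigr => z _; rewrite mulrDr. Qed.

Lemma traj_expect_M (c : R) f : traj_expect (fun w => c * f w) = c * traj_expect f.
Proof. by rewrite /traj_expect /hist_expect mulr_sumr; apply: eq_bigr => z _; rewrite mulrCA. Qed.

Lemma traj_expect_sum (I : Type) (r : seq I) (F : I -> Omega -> R) :
  traj_expect (fun w => \sum_(i <- r) F i w) = \sum_(i <- r) traj_expect (F i).
Proof.
rewrite /traj_expect /hist_expect exchange_big; apply: eq_bigr => z _ /=.
by rewrite mulr_sumr.
Qed.

Lemma le_traj_expect f g : (forall w, f w <= g w) -> traj_expect f <= traj_expect g.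
Proof. by move=> fg; apply: ler_sum => z _; rewrite ler_wpM2l ?hist_prob_ge0. Qed.

Lemma traj_expect_X0 (f : S -> R) : traj_expect (fun w => f (X 0 w)) = f s0.
Proof.
rewrite (@traj_expect_hist 0)//; last by move=> w w' /= ->.
rewrite /hist_expect (bigD1 s0)//= eqxx mul1r big1 ?addr0 => [|z /negPf ->]; last first.
  by rewrite mul0r.
congr f; apply: (@realizationE 0 s0) => //=.
by rewrite eqxx ltr01.
Qed.

Lemma traj_expect_cst (c : R) : traj_expect (fun=> c) = c.
Proof. exact: (traj_expect_X0 (fun=> c)). Qed.

(** The induction moves the conditioning time: the past is read at [n.+1] with one step fewer to go,
    then the step from [n] to [n.+1] is integrated out. *)
Lemma traj_expect_steps n t f s : (n + t <= N)%N -> adapted n f ->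
  traj_expect (fun w => f w * (X (n + t) w == s)%:R) =
  traj_expect (fun w => f w * steps (state_trans M pi) t (X n w) s).
Proof.
elim: t n f => [|t IH] n f nt af; first by rewrite addn0.
rewrite -addSnnS in nt *; rewrite IH//; last exact: adapted_le af.
rewrite (@traj_expect_markov n (fun w _ s' => f w * steps (state_trans M pi) t s' s)); last 2 first.
- by apply: leq_trans nt; rewrite ltnS leq_addr.
- by move=> _ s' w w' Hw; rewrite (af _ _ Hw).
apply: eq_traj_expect => w; rewrite /expect /= /state_trans.
under [in RHS]eq_bigr do rewrite mulr_suml.
rewrite exchange_big mulr_sumr; apply: eq_bigr => a _ /=.
rewrite !mulr_sumr; apply: eq_bigr => s' _; ring.
Qed.

(** The conditional expectation behind one TD sample: [G] is frozen at time [n], the start of a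
    batch, while the transition occurs [t] steps later. *)
Lemma traj_expect_transition n t s a (G : Omega -> S -> R) : (n + t < N)%N ->
  (forall s', adapted n (fun w => G w s')) ->
  traj_expect (fun w => ((X (n + t) w == s) && (Y (n + t) w == a))%:R * G w (X (n + t).+1 w)) =
  traj_expect (fun w => steps (state_trans M pi) t (X n w) s * pi s a * expect (trans M s a) (G w)).
Proof.
move=> ntN aG.
rewrite (@traj_expect_markov (n + t)
  (fun w b s' => ((X (n + t) w == s) && (b == a))%:R * G w s'))//; last first.
  move=> b s' w w' Hw; rewrite (adapted_X (leqnn _) Hw) (aG s' w w')//.
  by apply: history_le Hw; exact: leq_addr.
transitivity (traj_expect (fun w => (pi s a * expect (trans M s a) (G w)) * (X (n + t) w == s)%:R)).
  apply: eq_traj_expect => w; have [->|_] := eqVneq (X (n + t) w) s.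
    rewrite /expect (bigD1 a)//= [X in _ + X]big1 ?addr0 => [|b /negPf ba].
      by rewrite mulr1; congr (_ * _); apply: eq_bigr => s' _; rewrite eqxx mul1r.
    by rewrite big1 ?mulr0// => s' _; rewrite ba mul0r mulr0.
  rewrite mulr0 /expect big1// => b _.
  by rewrite big1 ?mulr0// => s' _; rewrite mul0r mulr0.
rewrite traj_expect_steps//; last 2 first.
- exact: ltnW.
- by move=> w w' Hw; congr (_ * _); apply: eq_bigr => s' _; rewrite (aG s' w w').
by apply: eq_traj_expect => w; ring.
Qed.

Lemma integral_adapted f : adapted N f -> (\int[P]_w (f w)%:E)%E = (traj_expect f)%:E.
Proof.
move=> af; transitivity (\int[P]_w (f (realization (history N w)))%:E)%E.
  by apply: eq_integral => w _; rewrite (af _ _ (@realizationK N w)).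
have mh (z : hist N) : measurable (history N @^-1` [set z]).
  exact: history_measurable.
rewrite (integral_finite P (fun z => f (realization z)) mh) -sumEFin.
by apply: eq_bigr => z _; rewrite history_prob -EFinM mulrC.
Qed.

End Expectation.
End Trajectory.

Arguments hist S A n : clear implicits.

(** * Existence of trajectories and the value function *)

Section Cumulative.
Context {R : realType} {Z : finType}.
Variable p : Z -> R.
Hypothesis hp : simplex p.

Definition cumul (k : nat) : R := \sum_(z | (enum_rank z < k)%N) p z.

Lemma cumulS z : cumul (enum_rank z).+1 = cumul (enum_rank z) + p z.
Proof.
rewrite /cumul (bigD1 z)//= addrC; congr (_ + _); apply: eq_bigl => v.
rewrite ltnS [in RHS]ltn_neqAle andbC; congr (_ && _).
by rewrite (inj_eq val_inj) (inj_eq enum_rank_inj).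
Qed.

Lemma cumul_le k l : (k <= l)%N -> cumul k <= cumul l.
Proof.
move=> kl; rewrite [leRHS](bigID (fun z => (enum_rank z < k)%N)) /=.
rewrite [X in X + _](eq_bigl (fun z => (enum_rank z < k)%N)).
  by rewrite lerDl; apply: sumr_ge0 => z _; case: hp.
move=> z; case: (ltnP (enum_rank z) k); rewrite ?andbT ?andbF// => zk.
by rewrite (leq_trans zk kl).
Qed.

Lemma cumul0 : cumul 0 = 0.
Proof. exact: big_pred0_eq. Qed.

Lemma cumul_full : cumul #|Z| = 1.
Proof.
by rewrite -(proj2 hp); apply: eq_bigl => z; rewrite ltn_ord.
Qed.

Lemma cumul_ge0 k : 0 <= cumul k.
Proof. by rewrite -cumul0; exact: cumul_le. Qed.

Lemma cumul_le1 z : cumul (enum_rank z) + p z <= 1.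
Proof. by rewrite -cumulS -cumul_full; apply: cumul_le; exact: ltn_ord. Qed.

(** Inverse transform sampling: take the value just below the least [k] with [v < cumul k]. *)
Lemma cumul_select v : 0 <= v < 1 ->
  exists z, cumul (enum_rank z) <= v < cumul (enum_rank z) + p z.
Proof.
move=> /andP[v0 v1].
have [k vk kmin] : {k | v < cumul k & forall l, v < cumul l -> (k <= l)%N}.
  have ex : exists k, v < cumul k by exists #|Z|; rewrite cumul_full.
  by case: (ex_minnP ex) => k ? ?; exists k.
case: k => [|k] in vk kmin; first by rewrite cumul0 ltNge v0 in vk.
have kZ : (k < #|Z|)%N.
  rewrite ltnNge; apply/negP => Zk; have := kmin #|Z|.
  by rewrite cumul_full v1 => /(_ isT); rewrite leqNgt ltnS Zk.
exists (enum_val (Ordinal kZ)); rewrite -cumulS enum_valK /= vk andbT.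
by rewrite leNgt; apply/negP => /kmin; rewrite ltnn.
Qed.

End Cumulative.

(** * Realization of all trajectories on the unit interval *)

Section Coupling.
Context {R : realType} {S A : finType} (M : @mdp R S A).
Variables (pi : S -> A -> R) (s0 : S).
Hypothesis hpi : policies pi.
Local Notation prob z := (hist_prob M pi s0 z).

Definition move_prob (s : S) (u : A * S) : R := pi s u.1 * trans M s u.1 u.2.

Lemma move_prob_simplex s : simplex (move_prob s).
Proof.
split=> [u|].
  by apply: mulr_ge0; [case: (hpi s)|case: (trans_simplex M s u.1)].
rewrite -(pair_big xpredT xpredT (fun a s' => pi s a * trans M s a s')) /=.
rewrite -(proj2 (hpi s)); apply: eq_bigr => a _.
by rewrite -mulr_sumr (proj2 (trans_simplex M _ _)) mulr1.
Qed.

(* Trajectories are realized on [0, 1[ with the uniform law: histories of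
   length n split it into consecutive intervals of length hist_prob. *)
Fixpoint hist_left (n : nat) : hist S A n -> R :=
  match n with
  | 0 => fun=> 0
  | n'.+1 => fun z => hist_left z.1 +
      prob z.1 * cumul (move_prob (hist_last z.1)) (enum_rank z.2)
  end.

Definition hist_itv n (z : hist S A n) (v : R) : bool :=
  hist_left z <= v < hist_left z + prob z.

Lemma hist_itv_sub n (z : hist S A n) u v :
  hist_itv (n := n.+1) (z, u) v -> hist_itv z v.
Proof.
have p0 : 0 <= prob z := hist_prob_ge0 M s0 hpi z.
have ms := move_prob_simplex (hist_last z).
rewrite /hist_itv /= -/(move_prob (hist_last z) u) => /andP[v0 v1]; apply/andP; split.
  by apply: le_trans v0; rewrite lerDl mulr_ge0// cumul_ge0.
apply: lt_le_trans v1 _; rewrite -addrA lerD2l -mulrDr -[leRHS]mulr1.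
by rewrite ler_wpM2l// cumul_le1.
Qed.

Lemma hist_itv_inj n (z z' : hist S A n) v :
  hist_itv z v -> hist_itv z' v -> z = z'.
Proof.
elim: n z z' => [|n IH] z z'.
  rewrite /hist_itv /= !add0r.
  have [->|zs] := eqVneq z s0; last by move=> /andP[v0 /(le_lt_trans v0)]; rewrite ltxx.
  by have [->|zs] := eqVneq z' s0 => // _ /andP[v0 /(le_lt_trans v0)]; rewrite ltxx.
case: z z' => z u [z' u'] zv zv'.
have E := IH _ _ (hist_itv_sub zv) (hist_itv_sub zv').
subst z'; congr (_, _).
have p0 : 0 <= prob z := hist_prob_ge0 M s0 hpi z.
have ms := move_prob_simplex (hist_last z).
have key (w w' : A * S) : hist_itv (n := n.+1) (z, w) v -> hist_itv (n := n.+1) (z, w') v ->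
    (enum_rank w' <= enum_rank w)%N.
  rewrite /hist_itv /= -!/(move_prob (hist_last z) _) => /andP[_ w1] /andP[w0 _].
  rewrite leqNgt; apply/negP => ww'; have := le_lt_trans w0 w1.
  rewrite -addrA ltrD2l -mulrDr -cumulS ltNge ler_wpM2l//.
  exact: cumul_le.
by apply/enum_rank_inj/val_inj/eqP; rewrite eqn_leq !key.
Qed.

Lemma hist_itv_extend n (z : hist S A n) v : hist_itv z v ->
  exists u, hist_itv (n := n.+1) (z, u) v.
Proof.
move=> /andP[v0 v1].
have p0 : 0 < prob z by have := le_lt_trans v0 v1; rewrite ltrDl.
have ms := move_prob_simplex (hist_last z).
(* The relative position of [v] inside the interval of [z] selects the next move. *)
have [|u /andP[u0 u1]] := cumul_select ms (v := (v - hist_left z) / prob z).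
  rewrite divr_ge0 ?subr_ge0 ?(ltW p0)//=.
  by rewrite ltr_pdivrMr// mul1r ltrBlDl.
exists u; rewrite /hist_itv /= -/(move_prob _ _) -addrA -mulrDr.
by rewrite -lerBrDl -ltrBlDl mulrC -ler_pdivlMr// u0 mulrC -ltr_pdivrMr.
Qed.

Lemma move_default : {u : A * S | True}.
Proof.
have := action_nonempty M; rewrite -[#|A|]/#|[pred a : A | true]|.
case: (pickP [pred a : A | true]) => [a _|A0]; first by exists (a, s0).
by rewrite eq_card0.
Qed.

Fixpoint hist_at (n : nat) (v : R) : hist S A n :=
  match n with
  | 0 => s0
  | n'.+1 => (hist_at n' v,
      odflt (sval move_default)
        [pick u | hist_itv (n := n'.+1) (hist_at n' v, u) v])
  end.

Lemma hist_at_itv n v : 0 <= v < 1 -> hist_itv (hist_at n v) v.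
Proof.
move=> v01; elim: n => [|n IH]; first by rewrite /hist_itv /= eqxx add0r.
have [u hu] := hist_itv_extend IH.
by rewrite /hist_at -/hist_at; case: pickP => [//|/(_ u)]; rewrite hu.
Qed.

Lemma hist_itv01 n (z : hist S A n) v : hist_itv z v -> 0 <= v < 1.
Proof.
elim: n z => [|n IH] z.
  rewrite /hist_itv /= add0r => /andP[-> /lt_le_trans]; apply.
  by case: eqP.
by case: z => z u /hist_itv_sub; exact: IH.
Qed.

(** The sample space is the whole real line under the uniform law; points outside the half-open unit
    interval are sent to 0 so that each of them carries a history. *)
Definition unit_part (v : R) : R := if 0 <= v < 1 then v else 0.

Lemma unit_part01 v : 0 <= unit_part v < 1.
Proof. by rewrite /unit_part; case: ifP => //; rewrite lexx ltr01. Qed.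

Definition coupled_X (t : nat) (v : measurableTypeR R) : S := hist_last (hist_at t (unit_part v)).
Definition coupled_Y (t : nat) (v : measurableTypeR R) : A := (hist_at t.+1 (unit_part v)).2.1.

Lemma coupled_history n v :
  history coupled_X coupled_Y n v = hist_at n (unit_part v).
Proof. elim: n => [//|n IH]; rewrite [LHS]/= IH /coupled_X /coupled_Y /=.
by rewrite -surjective_pairing. Qed.

(** The complement of the unit interval, a null set, joins the event of the history whose interval
    contains 0. *)
Lemma coupled_event n (z : hist S A n) :
  history coupled_X coupled_Y n @^-1` [set z] =
  [set v | hist_itv z v] `|`
  (if hist_itv z 0 then ~` [set` `[0, 1[] else set0).
Proof.
apply/seteqP; split=> v /=; rewrite coupled_history.
  move=> E; have := hist_at_itv n (unit_part01 v); rewrite E /unit_part.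
  case: ifPn => v01 zv; [by left|right].
  by rewrite zv /= in_itv /=; apply/negP.
have K := hist_at_itv n (unit_part01 v).
move=> [zv|]; last case: ifPn => // z0 /=.
  rewrite /unit_part (hist_itv01 zv) in K *; exact: hist_itv_inj zv.
rewrite in_itv /= => /negP/negbTE v01; rewrite /unit_part v01 in K *.
exact: hist_itv_inj z0.
Qed.

Lemma hist_itvE n (z : hist S A n) : [set v | hist_itv z v] =
  [set` `[hist_left z, hist_left z + prob z[].
Proof. by apply/seteqP; split=> v /=; rewrite in_itv. Qed.

Lemma coupled_measurable n (z : hist S A n) :
  measurable (history coupled_X coupled_Y n @^-1` [set z]).
Proof.
rewrite coupled_event; apply: measurableU; first by rewrite hist_itvE.
by case: ifP => // _; apply: measurableC.
Qed.

Lemma uniform_itv (l p : R) : 0 <= l -> 0 <= p -> l + p <= 1 ->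
  uniform_prob (@ltr01 R) [set` `[l, l + p[] = p%:E.
Proof.
move=> l0 p0 lp; rewrite /uniform_prob (eq_integral (fun=> 1%:E)) => [|x].
  rewrite integral_cst//= mul1e lebesgue_measure_itv /= lte_fin ltrDl.
  have [p1|p1] := ltP 0 p; first by rewrite -EFinD addrAC subrr add0r.
  by congr EFin; apply/le_anti; rewrite p0.
rewrite inE /= in_itv /= /uniform_pdf subr0 invr1 => /andP[lx xp].
by rewrite (le_trans l0 lx) (ltW (lt_le_trans xp lp)).
Qed.

Lemma hist_left01 n (z : hist S A n) :
  0 <= hist_left z /\ hist_left z + prob z <= 1.
Proof.
elim: n z => [|n IH] z; first by split=> //=; rewrite add0r; case: eqP.
have [l0 l1] := IH z.1; have ms := move_prob_simplex (hist_last z.1).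
have p0 : 0 <= prob z.1 := hist_prob_ge0 M s0 hpi z.1.
rewrite /= -/(move_prob _ z.2); split.
  by rewrite addr_ge0// mulr_ge0// cumul_ge0.
apply: le_trans l1; rewrite -addrA lerD2l -mulrDr -[leRHS]mulr1.
by rewrite ler_wpM2l// cumul_le1.
Qed.

Lemma coupled_prob n (z : hist S A n) :
  uniform_prob (@ltr01 R) (history coupled_X coupled_Y n @^-1` [set z]) =
  (prob z)%:E.
Proof.
have [l0 l1] := hist_left01 z; have p0 : 0 <= prob z := hist_prob_ge0 M s0 hpi z.
have C0 : uniform_prob (@ltr01 R) (~` [set` `[0, 1[]) = 0%E.
  rewrite probability_setC//.
  have := uniform_itv (lexx 0) ler01; rewrite add0r => U1.
  by rewrite [X in (_ - X)%E]U1// subee.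
pose C : set R := if hist_itv z 0 then ~` [set` `[0, 1[] else set0.
have mC : measurable C by rewrite /C; case: ifP => // _; exact: measurableC.
have disj : [set v | hist_itv z v] `&` C = set0.
  apply/seteqP; split=> v //= [/hist_itv01 v01]; rewrite /C; case: ifP.
    by rewrite /= in_itv /= v01.
  by [].
have mI : measurable [set v : R | hist_itv z v] by rewrite hist_itvE.
rewrite coupled_event -/C measureU// /C.
rewrite hist_itvE [X in (X + _)%E](uniform_itv l0 p0 l1).
by case: ifP => _; rewrite ?measure0 ?[X in (_ + X)%E]C0 adde0.
Qed.

Lemma coupled_trajectory N :
  is_trajectory M coupled_X coupled_Y (uniform_prob (@ltr01 R)) pi s0 N.
Proof.
split=> [t _ s|t _ a|x y].
- have -> : coupled_X t @^-1` [set s] = \bigcup_(z in [set z | hist_last z = s])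
      (history coupled_X coupled_Y t @^-1` [set z]).
    apply/seteqP; split=> v.
      move=> /= sv; exists (history coupled_X coupled_Y t v) => //=.
      by rewrite hist_last_history.
    by move=> [z /= <- <-]; rewrite hist_last_history.
  apply: fin_bigcup_measurable => // z _.
  exact: coupled_measurable.
- have -> : coupled_Y t @^-1` [set a] = \bigcup_(z in [set z : hist S A t.+1 | z.2.1 = a])
      (history coupled_X coupled_Y t.+1 @^-1` [set z]).
    apply/seteqP; split=> v.
      by move=> /= av; exists (history coupled_X coupled_Y t.+1 v).
    by move=> [z /= <- <-].
  apply: fin_bigcup_measurable => // z _.
  exact: coupled_measurable.
- rewrite -(hist_prob_of M pi s0) -coupled_prob; congr (uniform_prob _ _).
  by apply/seteqP; split=> w /traj_event_hist.
Qed.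

End Coupling.

Section Value.
Context {R : realType} {S A : finType} (M : @mdp R S A).
Variable pi : S -> A -> R.
Hypothesis hpi : policies pi.
Local Notation gamma := (discount M).

Section Return.
Context {d : measure_display} {Omega : measurableType d}.
Variables (X : nat -> Omega -> S) (Y : nat -> Omega -> A).
Variables (P : probability Omega R) (s0 : S).
Hypothesis traj : forall N, is_trajectory M X Y P pi s0 N.

Definition partial_return (n : nat) (w : Omega) : R :=
  \sum_(t < n) gamma ^+ t * reward M (X t w) (Y t w).

Lemma adapted_partial_return n : adapted X Y n (partial_return n).
Proof.
move=> w w' Hw; apply: eq_bigr => t _.
by rewrite (adapted_X (ltnW (ltn_ord t)) Hw) (adapted_Y (ltn_ord t) Hw).
Qed.

Lemma traj_expect_reward N t : (t < N)%N ->
  traj_expect M X Y P pi s0 N (fun w => reward M (X t w) (Y t w)) =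
  expect (steps (state_trans M pi) t s0) (fun s => expect (pi s) (reward M s)).
Proof.
move=> tN.
rewrite (traj_expect_markov hpi (traj N) (F := fun w a _ => reward M (X t w) a) tN); last first.
  by move=> a _ w w' Hw; rewrite (adapted_X (leqnn t) Hw).
pose r s := expect (pi s) (reward M s).
transitivity (traj_expect M X Y P pi s0 N (fun w => \sum_s r s * (X (0 + t) w == s)%:R)).
  apply: eq_traj_expect => w; rewrite add0n (bigD1 (X t w))//= eqxx mulr1 big1 ?addr0.
    apply: eq_bigr => a _; congr (_ * _).
    by rewrite /expect -mulr_suml (proj2 (trans_simplex M _ _)) mul1r.
  by move=> s /negPf; rewrite eq_sym => ->; rewrite mulr0.
rewrite traj_expect_sum /expect; apply: eq_bigr => s _.
rewrite (traj_expect_steps hpi (traj N) (n := 0) (f := fun=> r s))//; last exact: ltnW.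
rewrite traj_expect_M mulrC; congr (_ * _).
exact: (traj_expect_X0 hpi (traj N) (fun s' => steps (state_trans M pi) t s' s)).
Qed.

Lemma partial_return_integral n : (\int[P]_w (partial_return n w)%:E)%E =
  (\sum_(t < n) gamma ^+ t * expect (steps (state_trans M pi) t s0)
     (fun s => expect (pi s) (reward M s)))%:E.
Proof.
rewrite (integral_adapted (traj n)); last exact: adapted_partial_return.
congr EFin; rewrite traj_expect_sum; apply: eq_bigr => t _.
by rewrite traj_expect_M traj_expect_reward.
Qed.

Lemma reward_ge0 s a : 0 <= reward M s a.
Proof. by case/andP: (reward_itv M s a). Qed.

Lemma partial_return_nd w : {homo partial_return ^~ w : m n / (m <= n)%N >-> m <= n}.
Proof.
apply/nondecreasing_seqP => n; rewrite /partial_return big_ord_recr /= lerDl.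
by rewrite mulr_ge0 ?exprn_ge0 ?gamma_ge0// reward_ge0.
Qed.

Lemma partial_return_cvg w :
  partial_return n w @[n --> \oo] --> discounted_return M X Y w.
Proof.
apply: nondecreasing_is_cvgn; first exact: partial_return_nd.
exists ((1 - gamma)^-1) => _ [n _ <-]; apply: le_trans (geometric_le M n).
apply: ler_sum => t _; rewrite ler_piMr ?exprn_ge0 ?gamma_ge0//.
by case/andP: (reward_itv M (X t w) (Y t w)).
Qed.

Lemma measurable_partial_return n : measurable_fun setT (partial_return n).
Proof.
move=> _ B _; rewrite setTI.
have -> : partial_return n @^-1` B =
    \bigcup_(z in [set z | exists2 w, history X Y n w = z & B (partial_return n w)])
      (history X Y n @^-1` [set z]).
  apply/seteqP; split=> w; first by move=> Bw; exists (history X Y n w) => //; exists w.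
  by move=> [z [w' <- Bw'] /adapted_partial_return /= ->].
apply: fin_bigcup_measurable => // z _.
exact: (history_measurable (traj n)).
Qed.

(** Rewards are nonnegative, so monotone convergence exchanges the expectation with the infinite
    sum; each partial return depends on a finite history only. *)
Lemma expectation_return :
  ('E_P[discounted_return M X Y] = (policy_value M pi s0)%:E)%E.
Proof.
rewrite unlock.
have C : (fun n => \int[P]_w (partial_return n w)%:E)%E @ \oo -->
    (\int[P]_w (discounted_return M X Y w)%:E)%E.
  rewrite (eq_integral (fun w => limn (fun n => (partial_return n w)%:E))).
    apply: cvg_monotone_convergence => //.
    - move=> n; apply/measurable_realfun.measurable_EFinP.
      exact: measurable_partial_return.
    - move=> n w _; rewrite lee_fin; apply: sumr_ge0 => t _.
      by rewrite mulr_ge0 ?exprn_ge0 ?gamma_ge0// reward_ge0.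
    - by move=> w _ m n mn; rewrite lee_fin partial_return_nd.
  move=> w _; apply/esym/cvg_lim => //; apply: cvg_EFin.
    by apply: nearW.
  exact: partial_return_cvg.
rewrite (_ : (fun n => _) = (fun n => (\sum_(t < n) gamma ^+ t *
    expect (steps (state_trans M pi) t s0)
      (fun s => expect (pi s) (reward M s)))%:E)) in C; last first.
  by apply/funext => n; rewrite partial_return_integral.
have C2 := @discounted_steps_expect_cvg _ _ _ M pi hpi s0
  (fun s => expect (pi s) (reward M s)).
suff C3 : (fun n => (\sum_(t < n) gamma ^+ t *
    expect (steps (state_trans M pi) t s0)
      (fun s => expect (pi s) (reward M s)))%:E) @ \oo --> (policy_value M pi s0)%:E.
  exact: (cvg_unique _ C C3).
by apply: cvg_EFin; [exact: nearW|exact: C2].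
Qed.

End Return.

(** [get] is meaningful only on a nonempty set: the coupled trajectory is a witness, and by
    [expectation_return] the set has no other member than [policy_value M pi s0]. *)
Lemma valueE s0 : value M pi s0 = policy_value M pi s0.
Proof.
rewrite /value; set V := [set v : R | _].
have Vv : V (policy_value M pi s0).
  exists _, _, (uniform_prob (@ltr01 R)), (coupled_X M pi s0), (coupled_Y M pi s0).
  split; first exact: coupled_trajectory.
  by apply: expectation_return; exact: coupled_trajectory.
have [d [] Omega [P [X [Y [traj]]]]] := getI Vv.
by rewrite (expectation_return traj) => -[].
Qed.

End Value.

(** * The TD-PMD run *)

(** Both vectors sum to 1, so the gap at [x] is compensated by the other points and counts twice in
    the sum; this absorbs the factor [2^-1]. *)
Lemma tv_dist_ge (R : realType) (X : finType) (p q : X -> R) x :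
  simplex p -> simplex q -> `|p x - q x| <= tv_dist p q.
Proof.
move=> [_ p1] [_ q1]; rewrite /tv_dist mulrC ler_pdivlMr//.
rewrite (bigD1 x)//= mulr_natr mulr2n lerD2l.
have -> : p x - q x = - \sum_(y | y != x) (p y - q y).
  apply/eqP; rewrite -addr_eq0; apply/eqP.
  transitivity (\sum_y (p y - q y)); first by rewrite [RHS](bigD1 x).
  by rewrite sumrB p1 q1 subrr.
by rewrite normrN; exact: ler_norm_sum.
Qed.

Lemma stationary_steps (R : realType) (S : finType) (T : S -> S -> R) (nu : S -> R) t s :
  stationary T nu -> \sum_z nu z * steps T t z s = nu s.
Proof.
move=> [_ st]; elim: t => [|t IH] /=.
  rewrite (bigD1 s)//= eqxx mulr1 big1 ?addr0// => z /negPf ->.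
  by rewrite mulr0.
rewrite -[RHS]IH; under [RHS]eq_bigr do rewrite -st mulr_suml.
rewrite exchange_big; apply: eq_bigr => z _; rewrite mulr_sumr.
by apply: eq_bigr => u _; rewrite mulrA.
Qed.

Lemma stationary_gt0 (R : realType) (S : finType) (T : S -> S -> R) (nu : S -> R) s :
  (forall z, simplex (T z)) -> irreducible T -> stationary T nu -> 0 < nu s.
Proof.
move=> hT irr st; have [[nu0 nu1] _] := st.
have [z z0] : exists z, 0 < nu z.
  apply/existsP; apply: contraT => /existsPn H.
  suff : \sum_z nu z = 0 by rewrite nu1 => /eqP; rewrite oner_eq0.
  by apply: big1 => z _; apply/le_anti; rewrite nu0 leNgt H.
have [t t0] := irr z s.
rewrite -(stationary_steps t s st) (bigD1 z)//= ltr_pwDl ?mulr_gt0//.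
apply: sumr_ge0 => u _; rewrite mulr_ge0//.
by case: (steps_simplex hT t u).
Qed.

Lemma min_prob_le (R : realType) (X Y : finType) (f : X -> Y -> R) x y :
  min_prob f <= f x y.
Proof. exact: (bigmin_le_cond _ (fun z : X * Y => f z.1 z.2) (j := (x, y))). Qed.

Lemma min_prob_le1 (R : realType) (X Y : finType) (f : X -> Y -> R) : min_prob f <= 1.
Proof. exact: bigmin_le_id. Qed.

Lemma min_prob_gt0 (R : realType) (X Y : finType) (f : X -> Y -> R) :
  (forall x y, 0 < f x y) -> 0 < min_prob f.
Proof. by move=> f0; apply: lt_bigmin. Qed.

(** * Geometric weights and the mixing bias *)

Section Weights.
Context {R : realType} (theta : R) (B : nat).
Hypotheses (B_gt0 : (0 < B)%N) (theta01 : 0 <= theta <= 1).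
Local Notation c := (geometric_weight theta B).

Let theta0 : 0 <= theta. Proof. by case/andP: theta01. Qed.

Lemma geometric_norm_ge1 : 1 <= \sum_(i < B) theta ^+ i.
Proof.
case: B B_gt0 => // b _; rewrite big_ord_recl expr0 lerDl.
by apply: sumr_ge0 => i _; exact: exprn_ge0.
Qed.

Lemma geometric_weight_ge0 t : 0 <= c t.
Proof.
by rewrite divr_ge0 ?exprn_ge0// (le_trans ler01)// geometric_norm_ge1.
Qed.

Lemma geometric_weight_sum : \sum_(t < B) c t = 1.
Proof.
rewrite -mulr_suml (reindex_inj rev_ord_inj) /=.
rewrite (eq_bigr (fun i : 'I_B => theta ^+ i)) => [|i _].
  by rewrite divff// gt_eqF// (lt_le_trans ltr01)// geometric_norm_ge1.
by rewrite -subnDA addn1 subnSK// subKn// ltnW.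
Qed.

(** The convolution [G] of the two geometric sequences satisfies [theta ^+ B - kappa ^+ B = (theta -
    kappa) * G]. For [theta < 1] the normalization [N] is only bounded below by 1; for [theta = 1]
    it equals [B], whence the last case of [Psi]. *)
Lemma geometric_bias_le (gamma m kappa : R) : 0 <= gamma < 1 -> 0 < m -> 0 < kappa < 1 ->
  (1 - gamma)^-1 * \sum_(t < B) c t * (m * kappa ^+ t) <= Psi gamma B theta m kappa.
Proof.
move=> /andP[g0 g1] m0 /andP[k0 k1].
set G := \sum_(t < B) theta ^+ (B.-1 - t) * kappa ^+ t.
set N := \sum_(i < B) theta ^+ i.
have N1 : 1 <= N := geometric_norm_ge1.
have G0 : 0 <= G by apply: sumr_ge0 => t _; rewrite mulr_ge0 ?exprn_ge0// ltW.
have diff : theta ^+ B - kappa ^+ B = (theta - kappa) * G by exact: subrXX.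
have -> : \sum_(t < B) c t * (m * kappa ^+ t) = m * G / N.
  rewrite /G mulr_sumr mulr_suml; apply: eq_bigr => t _.
  rewrite /geometric_weight -/N (_ : (B - t - 1)%N = (B.-1 - t)%N); first by ring.
  by rewrite -subn1 subnAC.
have q0 : 0 < (1 - gamma)^-1 by rewrite invr_gt0 subr_gt0.
have GN : m * G / N <= m * G.
  by rewrite ler_pdivrMr ?(lt_le_trans ltr01)// ler_peMr// mulr_ge0// ltW.
have main X : G <= X -> (1 - gamma)^-1 * (m * G / N) <= m / (1 - gamma) * X.
  move=> GX; have -> : m / (1 - gamma) * X = (1 - gamma)^-1 * (m * X) by ring.
  rewrite ler_wpM2l ?(ltW q0)//.
  by apply: le_trans GN _; rewrite ler_wpM2l// ltW.
rewrite /Psi; case: ltP => [tk|kt].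
  have -> : m / ((1 - gamma) * (kappa - theta)) * kappa ^+ B =
      m / (1 - gamma) * (kappa ^+ B / (kappa - theta)) by rewrite invfM; ring.
  apply: main; rewrite ler_pdivlMr ?subr_gt0//.
  have := exprn_ge0 B theta0; have := diff; lra.
case: eqP => [tk|/eqP tk].
  rewrite -[leRHS]mulrA; apply: main; rewrite le_eqVlt; apply/orP; left; apply/eqP.
  rewrite /G (eq_bigr (fun=> theta ^+ (B - 1))) => [|t _].
    by rewrite sumr_const card_ord mulr_natl.
  by rewrite -tk -exprD subnK ?subn1// -ltnS prednK.
have {}kt : kappa < theta by rewrite lt_neqAle eq_sym tk.
case: ltP => [t1|t1].
  have -> : m / ((1 - gamma) * (theta - kappa)) * theta ^+ B =
      m / (1 - gamma) * (theta ^+ B / (theta - kappa)) by rewrite invfM; ring.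
  apply: main; rewrite ler_pdivlMr ?subr_gt0//.
  have := exprn_ge0 B (ltW k0); have := diff; lra.
have {t1} tE : theta = 1 by apply/le_anti; rewrite t1; case/andP: theta01 => _ ->.
have NE : N = B%:R.
  rewrite /N tE (eq_bigr (fun=> 1)) => [|i _]; last by rewrite expr1n.
  by rewrite sumr_const card_ord.
have B0 : 0 < B%:R :> R by rewrite ltr0n.
rewrite NE.
have -> : m / (B%:R * (1 - gamma) * (1 - kappa)) =
    (1 - gamma)^-1 * (m * (1 - kappa)^-1 / B%:R) by rewrite !invfM; ring.
rewrite ler_wpM2l ?(ltW q0)// ler_wpM2r ?invr_ge0 ?(ltW B0)//.
rewrite ler_wpM2l ?(ltW m0)// -[leRHS]mul1r ler_pdivlMr ?subr_gt0//.
by have := exprn_ge0 B (ltW k0); move: diff; rewrite tE expr1n; lra.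
Qed.

End Weights.

Lemma abel_sum (R : realFieldType) (K : nat) (u v : nat -> R) :
  \sum_(k < K.+1) u k * (v k.+1 - v k) =
  u K * v K.+1 - u 0%N * v 0%N - \sum_(k < K) (u k.+1 - u k) * v k.+1.
Proof.
elim: K => [|K IH]; first by rewrite big_ord_recl !big_ord0 /=; ring.
by rewrite big_ord_recr IH [in RHS]big_ord_recr /=; ring.
Qed.

(** One boundary term of the summation by parts vanishes with [v 0%N] and the other has the
    favourable sign, so only the variation of [u] is paid for. *)
Lemma abel_bound (R : realFieldType) (K : nat) (u v : nat -> R) (q : R) :
  v 0%N = 0 -> (forall k, (k <= K.+1)%N -> 0 <= v k <= q) ->
  (forall k, (k <= K)%N -> 0 <= u k) ->
  - \sum_(k < K.+1) u k * (v k.+1 - v k) <= q * \sum_(k < K) `|u k.+1 - u k|.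
Proof.
move=> v0 vq u0; rewrite abel_sum v0 mulr0 subr0 opprB lerBlDr.
apply: ler_wpDr.
  by rewrite mulr_ge0 ?u0//; case/andP: (vq K.+1 (leqnn _)).
rewrite mulr_sumr; apply: ler_sum => k _.
have /andP[vk0 vk1] := vq k.+1 (ltnW (ltn_ord k)).
rewrite (le_trans (ler_norm _))// normrM mulrC ler_wpM2r//.
by rewrite ger0_norm.
Qed.

Lemma expect_itv (R : realType) (X : finType) (p f : X -> R) (c : R) :
  simplex p -> (forall x, 0 <= f x <= c) -> 0 <= expect p f <= c.
Proof.
move=> [p0 p1] fc; apply/andP; split.
  by apply: sumr_ge0 => x _; rewrite mulr_ge0//; case/andP: (fc x).
rewrite -[leRHS]mul1r -p1 mulr_suml; apply: ler_sum => x _.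
by rewrite ler_wpM2l//; case/andP: (fc x).
Qed.

Lemma expect_affine (R : realType) (X : finType) (p f : X -> R) (a b g e : R) :
  simplex p ->
  expect p (fun x => a * (b + g * f x - e)) = a * (b + g * expect p f - e).
Proof.
move=> [_ p1]; transitivity (\sum_x (a * (b - e) * p x + a * g * (p x * f x))).
  by apply: eq_bigr => x _; ring.
by rewrite big_split -!mulr_sumr p1 /expect /=; ring.
Qed.

Lemma sum2_affine (R : realType) (I J : finType) (a q : R) (v G : I -> J -> R) :
  \sum_i \sum_j a * (v i j * q + q * G i j) =
  a * (q * (\sum_i \sum_j v i j) + q * (\sum_i \sum_j G i j)).
Proof.
rewrite mulrDr !mulr_sumr -big_split; apply: eq_bigr => i _ /=.
by rewrite !mulr_sumr -big_split; apply: eq_bigr => j _ /=; ring.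
Qed.

Lemma telescope_sumr_ord (V : zmodType) (K : nat) (u : nat -> V) :
  \sum_(k < K.+1) (u k.+1 - u k) = u K.+1 - u 0%N.
Proof. by rewrite -(big_mkord xpredT (fun k => u k.+1 - u k)) telescope_sumr. Qed.

Lemma td_errorE (R : realType) (S A : finType) (M : @mdp R S A)
    (Q pi : S -> A -> R) st at_ st' s a :
  td_error M Q pi st at_ st' s a = ((st == s) && (at_ == a))%:R *
    (reward M s a + discount M * expect (pi st') (Q st') - Q s a).
Proof.
by rewrite /td_error; case: andP => [[/eqP -> /eqP ->]|_] //; rewrite !mul0r.
Qed.

(** * Invariants of the run and the conditional TD update *)

Section Run.
Context {R : realType} {S A : finType} (M : @mdp R S A).
Variables (h : 'rV[R]_#|A| -> \bar R) (lambda : R) (p : \bar R).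
Hypotheses (hh : mirror_map h) (lambda_gt0 : 0 < lambda) (p_ge1 : (1 <= p)%E).
Hypothesis h_strong : strongly_convex_on vsimplex lambda p h.
Variables (pib pi0 pistar : S -> A -> R) (mu nu : S -> R) (s0 : S) (K B : nat).
Hypothesis pib_policy : policies pib.
Hypothesis pi0_policy : policies pi0.
Hypothesis pi0_interior : forall s, (dom h)° (vec (pi0 s)).
Hypothesis pistar_policy : policies pistar.
Hypotheses (mu_simplex : simplex mu) (B_gt0 : (0 < B)%N).
Variables (eta alpha theta : R).
Hypotheses (eta_ge0 : 0 <= eta) (alpha_itv : 0 < alpha <= 1).
Hypothesis theta_itv : 0 <= theta <= 1.
Context {d : measure_display} {Omega : measurableType d}.
Variables (P : probability Omega R) (X : nat -> Omega -> S) (Y : nat -> Omega -> A).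
Hypothesis traj : is_trajectory M X Y P pib s0 (batch_start (fun=> B) K.+1).
Variables (Q pi : Omega -> nat -> S -> A -> R).
Hypothesis run : forall w, td_pmd_run h M K pi0 (fun=> eta) (fun=> alpha) (fun=> B)
  (fun=> geometric_weight theta B) (X ^~ w) (Y ^~ w) (Q w) (pi w).

Local Notation gamma := (discount M).
Local Notation q := ((1 - gamma)^-1).
Local Notation c := (geometric_weight theta B).
Local Notation Ex := (traj_expect M X Y P pib s0 (batch_start (fun=> B) K.+1)).
Local Notation n := (#|A|%:R : R).

Let q_gt0 : 0 < q. Proof. by rewrite invr_gt0 onem_gamma_gt0. Qed.

Lemma batch_startE k : batch_start (fun=> B) k = (k * B)%N.
Proof. by rewrite /batch_start sum_nat_const card_ord. Qed.

Lemma run_policy w k : (k <= K.+1)%N ->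
  policies (pi w k) /\ forall s, (dom h)° (vec (pi w k s)).
Proof.
have [pi00 _ steps] := run w; elim: k => [|k IH] kK; first by rewrite pi00.
have [_ int] := IH (ltnW kK); have [st _] := steps k kK.
split=> s; first by case: (st s).
exact: (pmd_interior hh (st s)).
Qed.

Lemma backup_itv (V : S -> R) s a : (forall s, 0 <= V s <= q) ->
  0 <= backup M V s a <= q.
Proof.
move=> Vq; have := expect_itv (trans_simplex M s a) Vq.
have := reward_itv M s a; have g0 := gamma_ge0 M; have g1 := onem_gamma_gt0 M.
rewrite /backup; move: (expect _ _) (reward _ _ _) => e r /andP[r0 r1] /andP[e0 e1].
rewrite addr_ge0 ?mulr_ge0//=.
have -> : q = 1 + gamma * q by field; rewrite gt_eqF.
by rewrite lerD// ler_wpM2l.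
Qed.

(** The update is a convex combination of the old entry and of the targets [G t]: the coefficients
    [b t] are nonnegative and sum to at most 1, because [alpha <= 1] and the weights sum to 1.
    Targets stay in the interval since [q = 1 + gamma * q]. *)
Lemma run_Q_itv w k s a : (k <= K.+1)%N -> 0 <= Q w k s a <= q.
Proof.
have [_ Q0 steps] := run w; elim: k s a => [|k IH] s a kK.
  by rewrite Q0 lexx ltW.
have [_ ->] := steps k kK; have [pk _] := run_policy w kK.
have {}IH s' a' := IH s' a' (ltnW kK).
have Vq s' : 0 <= expect (pi w k.+1 s') (Q w k s') <= q.
  exact: expect_itv.
set i := fun t => (batch_start (fun=> B) k + t)%N.
pose b t := alpha * c t * ((X (i t) w == s) && (Y (i t) w == a))%:R.
pose G t := reward M s a + gamma * expect (pi w k.+1 (X (i t).+1 w)) (Q w k (X (i t).+1 w)).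
have -> : Q w k s a + alpha * (\sum_(t < B) c t *
    td_error M (Q w k) (pi w k.+1) (X (i t) w) (Y (i t) w) (X (i t).+1 w) s a) =
    (1 - \sum_(t < B) b t) * Q w k s a + \sum_(t < B) b t * G t.
  rewrite mulrBl mul1r -addrA; congr (_ + _).
  rewrite mulr_suml -sumrN -big_split mulr_sumr; apply: eq_bigr => t _ /=.
  by rewrite /b /G td_errorE; ring.
have /andP[a0 a1] := alpha_itv.
have b0 t : 0 <= b t.
  by rewrite mulr_ge0 ?ler0n// mulr_ge0 ?(ltW a0)// geometric_weight_ge0.
have b1 : \sum_(t < B) b t <= 1.
  rewrite -(geometric_weight_sum B_gt0 theta_itv); apply: ler_sum => t _.
  rewrite /b mulrAC -[leRHS]mul1r ler_wpM2r ?geometric_weight_ge0//.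
  by rewrite mulr_ile1 ?ler0n ?(ltW a0)//; case: (_ && _).
have G01 t : 0 <= G t <= q.
  have /andP[r0 r1] := reward_itv M s a; have /andP[v0 v1] := Vq (X (i t).+1 w).
  have g0 := gamma_ge0 M; have g1 := onem_gamma_gt0 M.
  rewrite addr_ge0 ?mulr_ge0//=.
  have -> : q = 1 + gamma * q by field; rewrite gt_eqF.
  by rewrite lerD// ler_wpM2l.
have /andP[Q1 Q2] := IH s a; apply/andP; split.
  apply: addr_ge0; first by rewrite mulr_ge0// subr_ge0.
  by apply: sumr_ge0 => t _; rewrite mulr_ge0//; case/andP: (G01 t).
have -> : q = (1 - \sum_(t < B) b t) * q + \sum_(t < B) b t * q.
  by rewrite -mulr_suml; ring.
apply: lerD; first by rewrite ler_wpM2l// subr_ge0.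
by apply: ler_sum => t _; rewrite ler_wpM2l//; case/andP: (G01 t).
Qed.

Lemma run_adapted_next_of w w' k : (k <= K)%N ->
  Q w k = Q w' k -> pi w k = pi w' k -> pi w k.+1 = pi w' k.+1.
Proof.
move=> kK eQ epi; apply/funext => s.
have [_ _ steps] := run w; have [_ _ steps'] := run w'.
have [st _] := steps k kK; have [st' _] := steps' k kK.
have := st' s; rewrite -eQ -epi => st's.
have [pk ik] := run_policy w (leqW kK).
exact: esym (pmd_step_unique hh lambda_gt0 p_ge1 h_strong (st s) st's).
Qed.

(** The run is specified separately at each sample point. Two points with the same history have the
    same samples, hence the same critic updates, and the same policies by uniqueness of the mirror
    step. *)
Lemma run_adapted k : (k <= K.+1)%N ->
  adapted X Y (k * B) (fun w => (Q w k, pi w k)).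
Proof.
elim: k => [|k IH] kK w w' Hw.
  have [-> Q0 _] := run w; have [-> Q0' _] := run w'.
  by congr (_, _); apply/funext => s; apply/funext => a; rewrite Q0 Q0'.
have [eQ epi] : (Q w k, pi w k) = (Q w' k, pi w' k).
  by apply: (IH (ltnW kK)); apply: history_le Hw; rewrite leq_mul2r leqnSn orbT.
have epi' := run_adapted_next_of kK eQ epi.
congr (_, _) => //; apply/funext => s; apply/funext => a.
have [_ _ steps] := run w; have [_ _ steps'] := run w'.
have [_ ->] := steps k kK; have [_ ->] := steps' k kK.
rewrite eQ epi'; congr (_ + _ * _); apply: eq_bigr => t _; congr (_ * _).
have it : (batch_start (fun=> B) k + t < k.+1 * B)%N.
  by rewrite batch_startE mulSnr ltn_add2l.
rewrite /= (adapted_X (ltnW it) Hw) (adapted_X it Hw).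
by rewrite (adapted_Y it Hw).
Qed.

Lemma run_adapted_Q k : (k <= K.+1)%N -> adapted X Y (k * B) (Q ^~ k).
Proof. by move=> kK w w' /(run_adapted kK) []. Qed.

Lemma run_adapted_pi k : (k <= K.+1)%N -> adapted X Y (k * B) (pi ^~ k).
Proof. by move=> kK w w' /(run_adapted kK) []. Qed.

(** The policy of index [k.+1] is computed before batch [k] is drawn, so the residual of that batch
    is already determined at its start. *)
Lemma run_adapted_next k : (k <= K)%N -> adapted X Y (k * B) (pi ^~ k.+1).
Proof.
by move=> kK w w' /(run_adapted (leqW kK)) [eQ epi]; exact: run_adapted_next_of.
Qed.

Definition residual w k s a : R :=
  backup M (fun s' => expect (pi w k.+1 s') (Q w k s')) s a - Q w k s a.

Lemma residual_le w k s a : (k <= K)%N -> `|residual w k s a| <= q.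
Proof.
move=> kK; have [pk _] := run_policy w (k := k.+1) kK.
have Qk s' a' := run_Q_itv w s' a' (leqW kK).
have := @backup_itv (fun s' => expect (pi w k.+1 s') (Q w k s')) s a
  (fun s' => expect_itv (pk s') (Qk s')).
have := Qk s a; rewrite /residual ler_norml.
by move: (backup _ _ _ _) (Q _ _ _ _) => x y; lra.
Qed.

(** The weighted average of the conditional laws of the states in batch [k], given the state that
    opens it. *)
Definition batch_prob w k s : R :=
  \sum_(t < B) c t * steps (state_trans M pib) t (X (k * B)%N w) s.

Lemma expected_update k (phi : Omega -> R) s a : (k <= K)%N ->
  adapted X Y (k * B) phi ->
  Ex (fun w => phi w * (Q w k.+1 s a - Q w k s a)) =
  alpha * Ex (fun w => phi w * (batch_prob w k s * pib s a * residual w k s a)).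
Proof.
move=> kK aphi.
pose G w s' := phi w * (reward M s a + gamma * expect (pi w k.+1 s') (Q w k s') - Q w k s a).
have aG s' : adapted X Y (k * B) (G ^~ s').
  move=> w w' Hw; rewrite /G (aphi _ _ Hw) (run_adapted_next kK Hw).
  by rewrite (run_adapted_Q (leqW kK) Hw).
transitivity (Ex (fun w => \sum_(t < B) alpha * c t *
    (((X (k * B + t) w == s) && (Y (k * B + t) w == a))%:R *
      G w (X (k * B + t).+1 w)))).
  apply: eq_traj_expect => w; have [_ _ steps] := run w; have [_ ->] := steps k kK.
  rewrite addrAC subrr add0r !mulr_sumr batch_startE; apply: eq_bigr => t _.
  by rewrite /= td_errorE /G; ring.
rewrite traj_expect_sum -traj_expect_M.
transitivity (Ex (fun w => \sum_(t < B) alpha * c t *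
   (steps (state_trans M pib) t (X (k * B)%N w) s * pib s a *
     (phi w * residual w k s a)))); last first.
  apply: eq_traj_expect => w; rewrite /batch_prob !mulr_suml !mulr_sumr.
  by apply: eq_bigr => t _; ring.
rewrite traj_expect_sum; apply: eq_bigr => t _.
rewrite traj_expect_M [RHS]traj_expect_M; congr (_ * _).
rewrite (traj_expect_transition pib_policy traj)//; last first.
  rewrite batch_startE -addnS mulSn addnC leq_add// ?leq_mul2r ?kK ?orbT//.
apply: eq_traj_expect => w; congr (_ * _).
by rewrite /G (expect_affine _ _ _ _ _ (trans_simplex M s a)).
Qed.

(** * Bounds on the terms of the value gap *)

Hypothesis nu_stationary : stationary (state_trans M pib) nu.
Variable beta : R.
Hypothesis batch_bias : forall w k s, `|batch_prob w k s - nu s| <= beta.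
Local Notation sigma := (fun s a => nu s * pib s a).
Variable sigma_min : R.
Hypothesis sigma_min_gt0 : 0 < sigma_min.
Hypothesis sigma_ge : forall s a, sigma_min <= sigma s a.

Let beta_ge0 : 0 <= beta.
Proof.
have [w _] := omega_inhabited P.
exact: le_trans (normr_ge0 _) (batch_bias w 0 s0).
Qed.

Definition visit_gap w k s a : R :=
  visit_sa M pistar mu s a - visit_sa M (pi w k) mu s a.

(* Dividing by alpha * sigma turns the conditional expectation of the TD update
   into the residual, except that the law of the batch replaces nu: the
   difference is bias_term. *)
Definition update_term w k : R := \sum_s \sum_a
  (alpha * sigma s a)^-1 * (visit_gap w k s a * (Q w k.+1 s a - Q w k s a)).

Definition bias_term w k : R := \sum_s \sum_a
  (nu s)^-1 * (visit_gap w k s a * ((nu s - batch_prob w k s) * residual w k s a)).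

Lemma sigma_gt0 s a : 0 < sigma s a.
Proof. exact: lt_le_trans (sigma_ge s a). Qed.

Lemma nu_gt0 s : 0 < nu s.
Proof.
have /card_gt0P[a _] := action_nonempty M.
have np := sigma_gt0 s a; have [[nu0 _] _] := nu_stationary.
rewrite lt_neqAle nu0 andbT eq_sym.
by apply: contraTneq np => ->; rewrite mul0r ltxx.
Qed.

Lemma sigma_min_le_nu s : sigma_min <= nu s.
Proof.
have /card_gt0P[a _] := action_nonempty M.
apply: le_trans (sigma_ge s a) _.
by rewrite ler_piMr ?(ltW (nu_gt0 s))// (simplex_le1 a (pib_policy s)).
Qed.

Lemma traj_expect_residual k : (k <= K)%N ->
  Ex (fun w => \sum_s \sum_a visit_gap w k s a * residual w k s a) =
  Ex (update_term ^~ k) + Ex (bias_term ^~ k).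
Proof.
move=> kK.
have agap s a : adapted X Y (k * B) (fun w => visit_gap w k s a).
  by move=> w w' Hw; rewrite /visit_gap (run_adapted_pi (leqW kK) Hw).
have [a0 _] := andP alpha_itv.
have U : Ex (update_term ^~ k) = Ex (fun w => \sum_s \sum_a
    (sigma s a)^-1 * (visit_gap w k s a * (batch_prob w k s * pib s a * residual w k s a))).
  rewrite /update_term !traj_expect_sum; apply: eq_bigr => s _.
  rewrite !traj_expect_sum; apply: eq_bigr => a _.
  rewrite traj_expect_M [RHS]traj_expect_M expected_update// invfM mulrA; congr (_ * _).
  by rewrite mulrAC mulVf ?mul1r// gt_eqF.
(* What remains holds at each sample point: [batch_prob / nu + (nu - batch_prob) / nu = 1]. *)
rewrite U -traj_expect_D; apply: eq_traj_expect => w.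
rewrite /bias_term -big_split; apply: eq_bigr => s _ /=.
rewrite -big_split; apply: eq_bigr => a _ /=.
have n0 := nu_gt0 s; have s0' := sigma_gt0 s a.
have p0 : pib s a != 0 by apply: contraTneq s0' => ->; rewrite mulr0 ltxx.
by field; rewrite p0 gt_eqF.
Qed.

Lemma visit_gap_sum w k : (k <= K.+1)%N -> \sum_s \sum_a `|visit_gap w k s a| <= 2 * q.
Proof.
move=> kK; have [pk _] := run_policy w kK.
have -> : 2 * q = \sum_s \sum_a visit_sa M pistar mu s a +
    \sum_s \sum_a visit_sa M (pi w k) mu s a.
  by rewrite !visit_sa_sum//; ring.
rewrite -big_split; apply: ler_sum => s _ /=.
rewrite -big_split; apply: ler_sum => a _ /=.
by apply: le_trans (ler_normB _ _) _; rewrite !ger0_norm ?visit_sa_ge0.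
Qed.

(** The gap has mass at most [2 * q] and the residual is at most [q]. The behavior policy has
    cancelled, so only [(nu s)^-1], at most [sigma_min^-1], is left of the division. *)
Lemma bias_term_le w k : (k <= K)%N ->
  bias_term w k <= 2 * q ^+ 2 * beta / sigma_min.
Proof.
move=> kK; apply: (@le_trans _ _ (\sum_s \sum_a `|visit_gap w k s a| * (q * beta / sigma_min))).
  apply: ler_sum => s _; apply: ler_sum => a _.
  rewrite mulrCA; apply: le_trans (ler_norm _) _; rewrite normrM ler_wpM2l//.
  rewrite !normrM mulrC -[q * beta]mulrC.
  have n0 := nu_gt0 s.
  apply: ler_pM => //.
  - by rewrite mulrC [leLHS]mulrC; apply: ler_pM; rewrite ?residual_le// distrC.
  - by rewrite ger0_norm ?invr_ge0 ?(ltW n0)// lef_pV2 ?posrE// sigma_min_le_nu.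
have -> : 2 * q ^+ 2 * beta / sigma_min = 2 * q * (q * beta / sigma_min) by ring.
under eq_bigr do rewrite -mulr_suml.
rewrite -mulr_suml ler_wpM2r ?visit_gap_sum//; last exact: leqW.
by rewrite divr_ge0 ?mulr_ge0// ltW.
Qed.

Local Notation delta := (eta * q * n ^+ 2 / (2 * lambda)).

Lemma run_move w k s : (k <= K)%N ->
  \sum_a `|pi w k.+1 s a - pi w k s a| <= delta.
Proof.
move=> kK; have [_ _ steps] := run w; have [st _] := steps k kK.
have [pk ik] := run_policy w (leqW kK).
have := pmd_move hh lambda_gt0 p_ge1 h_strong (st s) (pk s) (ik s) eta_ge0 (ltW q_gt0).
by apply=> a; apply: run_Q_itv; exact: leqW.
Qed.

(** The weights from [pistar] do not depend on [k], so that part telescopes; the weights from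
    [pi w k] are summed by parts and pay their variation. [sigma s a] is replaced by its lower bound
    only once both parts are bounded by nonnegative quantities. *)
Lemma update_term_sum_le w : \sum_(k < K.+1) update_term w k <=
  q ^+ 2 / (alpha * sigma_min) + K%:R * (q ^+ 3 * delta / (alpha * sigma_min)).
Proof.
have [a0 _] := andP alpha_itv; have [_ Q0 _] := run w.
have as0 : 0 < alpha * sigma_min by exact: mulr_gt0.
have Ki k : (k <= K)%N -> policies (pi w k).
  by move=> kK; have [] := run_policy w (leqW kK).
rewrite exchange_big /=.
apply: (@le_trans _ _ (\sum_s \sum_a (alpha * sigma_min)^-1 *
   (visit_sa M pistar mu s a * q + q * \sum_(k < K)
     `|visit_sa M (pi w k.+1) mu s a - visit_sa M (pi w k) mu s a|))).
  apply: ler_sum => s _; rewrite exchange_big; apply: ler_sum => a _ /=.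
  rewrite -mulr_sumr.
  have sp : 0 < alpha * sigma s a by rewrite mulr_gt0// sigma_gt0.
  apply: (@le_trans _ _ ((alpha * sigma s a)^-1 *
   (visit_sa M pistar mu s a * q + q * \sum_(k < K)
     `|visit_sa M (pi w k.+1) mu s a - visit_sa M (pi w k) mu s a|))).
    rewrite ler_wpM2l ?invr_ge0 ?(ltW sp)//.
    under eq_bigr do rewrite /visit_gap mulrBl.
    rewrite sumrB; apply: lerD.
      rewrite -mulr_sumr (@telescope_sumr_ord _ K (fun k => Q w k s a)) Q0 subr0.
      rewrite ler_wpM2l ?visit_sa_ge0//.
      by case/andP: (run_Q_itv w s a (leqnn K.+1)).
    apply: (abel_bound (u := fun k => visit_sa M (pi w k) mu s a)
      (v := fun k => Q w k s a)) => // k kK; first exact: run_Q_itv.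
    by apply: visit_sa_ge0 => //; exact: Ki.
  rewrite ler_wpM2r//; last by rewrite lef_pV2 ?posrE// ler_pM2l.
  rewrite addr_ge0// mulr_ge0 ?visit_sa_ge0// ?(ltW q_gt0)//.
  by apply: sumr_ge0.
rewrite (sum2_affine _ q (visit_sa M pistar mu) (fun s a => \sum_(k < K)
  `|visit_sa M (pi w k.+1) mu s a - visit_sa M (pi w k) mu s a|)) visit_sa_sum//.
have -> : q ^+ 2 / (alpha * sigma_min) + K%:R * (q ^+ 3 * delta / (alpha * sigma_min)) =
  (alpha * sigma_min)^-1 * (q * q + q * (K%:R * (q ^+ 2 * delta))) by ring.
rewrite ler_wpM2l ?invr_ge0 ?(ltW as0)// lerD2l ler_wpM2l ?(ltW q_gt0)//.
under eq_bigr do rewrite exchange_big.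
rewrite exchange_big /= mulr_natl -[X in _ *+ X]card_ord -sumr_const.
apply: ler_sum => k _; apply: visit_sa_dist => //; try exact: Ki.
  by apply: Ki; exact: ltnW.
by move=> s; apply: run_move; exact: ltnW.
Qed.

Local Notation D0 := (div_norm h pistar pi0).

Definition greedy_term w k : R := \sum_s visit M pistar mu s *
  (expect (pistar s) (Q w k s) - expect (pi w k.+1 s) (Q w k s)).

(** The constant step size lets the divergences from [pistar] telescope state by state; the last of
    them and those between successive policies are nonnegative and dropped. The mass of [visit] is
    the factor [q]. *)
Lemma greedy_term_sum_le w : eta * \sum_(k < K.+1) greedy_term w k <= q * D0.
Proof.
rewrite /greedy_term exchange_big mulr_sumr -(visit_sum M pistar_policy mu_simplex) mulr_suml.
apply: ler_sum => s _; rewrite -mulr_sumr mulrCA ler_wpM2l ?visit_ge0//.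
have [pi00 _ steps] := run w.
apply: (@le_trans _ _ (action_div h (pistar s) (pi w 0 s) -
    action_div h (pistar s) (pi w K.+1 s))).
  rewrite mulr_sumr -opprB.
  rewrite -(@telescope_sumr_ord _ K (fun k => action_div h (pistar s) (pi w k s))) -sumrN.
  apply: ler_sum => k _; have [st _] := steps k (ltn_ord k).
  have [pk ik] := run_policy w (ltnW (ltn_ord k : (k < K.+1)%N)).
  have [pk' _] := run_policy w (ltn_ord k : (k.+1 <= K.+1)%N).
  have := pmd_three_point hh (st s) (pistar_policy s).
  have := action_div_ge0 hh lambda_gt0 h_strong (pk' s) (pk s) (ik s).
  by lra.
have [pK iK] := run_policy w (leqnn K.+1).
have := action_div_ge0 hh lambda_gt0 h_strong (pistar_policy s) (pK s) (iK s).
have : action_div h (pistar s) (pi0 s) <= D0.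
  exact: (le_bigmax _ (fun s => action_div h (pistar s) (pi0 s))).
by rewrite pi00; lra.
Qed.

Definition drift_term w k : R := \sum_s visit M (pi w k) mu s *
  (expect (pi w k.+1 s) (Q w k s) - expect (pi w k s) (Q w k s)).

Lemma drift_term_le w k : (k <= K)%N -> drift_term w k <= q ^+ 2 * delta / 2.
Proof.
move=> kK; have [pk _] := run_policy w (leqW kK).
have [pk' _] := run_policy w (k := k.+1) kK.
have -> : q ^+ 2 * delta / 2 = q * (q / 2 * delta) by ring.
rewrite -{1}(visit_sum M pk mu_simplex) mulr_suml; apply: ler_sum => s _.
rewrite ler_wpM2l ?visit_ge0//.
apply: le_trans (expect_diff_le (pk' s) (pk s) (c := q) _) _.
  by move=> a; apply: run_Q_itv; exact: leqW.
by rewrite ler_wpM2l ?divr_ge0 ?(ltW q_gt0)// run_move.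
Qed.

Definition value_diff w k : R :=
  expect mu (policy_value M pistar) - expect mu (policy_value M (pi w k)).

(** Only the exchange of the residual for the update needs the expectation; the separate bounds hold
    at every sample point and pass to [Ex] by monotonicity. *)
Lemma value_diff_sum_le : 0 < eta ->
  \sum_(k < K.+1) Ex (value_diff ^~ k) <=
  (q ^+ 2 / (alpha * sigma_min) + K%:R * (q ^+ 3 * delta / (alpha * sigma_min)))
  + (K.+1%:R * (2 * q ^+ 2 * beta / sigma_min)
     + (q * D0 / eta + K.+1%:R * (q ^+ 2 * delta / 2))).
Proof.
move=> eta0.
have gapE (k : 'I_K.+1) : Ex (value_diff ^~ k) =
    Ex (update_term ^~ k) + Ex (bias_term ^~ k) + Ex (fun w => greedy_term w k + drift_term w k).
  have kK : (k <= K)%N := ltn_ord k.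
  rewrite -traj_expect_residual// -traj_expect_D; apply: eq_traj_expect => w.
  have [pk _] := run_policy w (leqW kK).
  by rewrite /value_diff (value_gap M (pi w k.+1) (Q w k) mu pistar_policy pk) addrA.
rewrite (eq_bigr _ (fun k _ => gapE k)) !big_split /= -addrA; apply: lerD.
  rewrite -traj_expect_sum -[leRHS](traj_expect_cst pib_policy traj); apply: le_traj_expect => // w.
  exact: update_term_sum_le.
apply: lerD.
  rewrite mulr_natl -[X in _ *+ X]card_ord -sumr_const; apply: ler_sum => k _.
  rewrite -[leRHS](traj_expect_cst pib_policy traj); apply: le_traj_expect => // w.
  by apply: bias_term_le; exact: (ltn_ord k).
rewrite -traj_expect_sum -[leRHS](traj_expect_cst pib_policy traj); apply: le_traj_expect => // w.
rewrite big_split; apply: lerD.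
  by rewrite ler_pdivlMr// mulrC greedy_term_sum_le.
rewrite mulr_natl -[X in _ *+ X]card_ord -sumr_const; apply: ler_sum => k _.
by apply: drift_term_le; exact: (ltn_ord k).
Qed.

Section UniformIndex.
Variable Khat : Omega -> 'I_K.+1.
Hypothesis Khat_uniform :
  independent_uniform P X Y (batch_start (fun=> B) K.+1) Khat.

(** The integrand is a function of [Khat] and of the full history, a pair with finitely many values
    whose law is a product by independence. *)
Lemma expectation_value_diff : (forall s, value M pistar s = opt_value M s) ->
  ('E_P[fun w => (expect mu (opt_value M) - expect mu (value M (pi w (Khat w))))%R] =
   ((K.+1%:R)^-1 * \sum_(k < K.+1) Ex (value_diff ^~ k))%:E)%E.
Proof.
move=> opt; rewrite unlock; pose N := batch_start (fun=> B) K.+1.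
pose f (jz : 'I_K.+1 * hist S A N) := value_diff (realization X Y P jz.2) jz.1.
pose g w := (Khat w, history X Y N w).
have [mK PK PKX] := Khat_uniform.
have gE jz : g @^-1` [set jz] =
    Khat @^-1` [set jz.1] `&` history X Y N @^-1` [set jz.2].
  case: jz => j z; apply/seteqP.
  by split=> w /=; [move=> [-> ->]|move=> [<- <-]].
have mg jz : measurable (g @^-1` [set jz]).
  by rewrite gE; apply: measurableI => //; exact: (history_measurable traj).
transitivity (\int[P]_w (f (g w))%:E)%E.
  apply: eq_integral => w _; congr EFin; rewrite /f /value_diff /=.
  have kN : (Khat w * B <= N)%N.
    by rewrite /N batch_startE leq_mul2r (ltnW (ltn_ord _)) orbT.
  have -> : pi (realization X Y P (history X Y N w)) (Khat w) = pi w (Khat w).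
    apply: (run_adapted_pi (ltnW (ltn_ord (Khat w)))).
    by apply: (history_le kN); exact: realizationK.
  have [pk _] := run_policy w (ltnW (ltn_ord (Khat w))).
  congr (_ - _); apply: eq_bigr => s _; congr (_ * _); last exact: valueE.
  by rewrite -opt valueE.
rewrite (integral_finite P f mg) mulr_sumr -sumEFin.
transitivity (\sum_j \sum_z ((f (j, z))%:E * P (g @^-1` [set (j, z)])))%E.
  by rewrite pair_big; apply: eq_bigr => -[].
apply: eq_bigr => j _; rewrite /traj_expect /hist_expect mulr_sumr -sumEFin.
apply: eq_bigr => z _; rewrite gE /=.
have -> : P (Khat @^-1` [set j] `&` history X Y N @^-1` [set z]) =
    ((K.+1%:R)^-1 * hist_prob M pib s0 z)%:E.
  rewrite EFinM -(history_prob traj) -(PK j).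
  have [x [y <-]] := hist_of_surj M z.
  have <- : traj_event X Y N x y = history X Y N @^-1` [set hist_of x y N].
    by apply/seteqP; split=> w /traj_event_hist.
  exact: PKX.
by rewrite -EFinM; congr EFin; rewrite /f /=; ring.
Qed.

End UniformIndex.

(* The step size vanishes exactly when D0 = 0, that is, when pi0 = pistar. *)
Lemma run_constant w k : eta = 0 -> (k <= K.+1)%N -> pi w k = pi0.
Proof.
move=> eta0; elim: k => [|k IH] kK; first by have [] := run w.
rewrite -IH; last exact: ltnW.
apply/funext => s; apply/funext => a.
have := run_move w s kK; rewrite eta0 !mul0r => H.
apply/eqP; rewrite -subr_eq0 -normr_le0; apply: le_trans H.
by rewrite (bigD1 a)//= lerDl; apply: sumr_ge0.
Qed.

Lemma value_diff0 w k : eta = 0 -> D0 <= 0 -> (k <= K.+1)%N -> value_diff w k = 0.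
Proof.
move=> eta0 D00 kK; rewrite /value_diff run_constant//.
suff -> : pistar = pi0 by rewrite subrr.
apply/funext => s.
apply: (action_div_eq0 hh lambda_gt0 p_ge1 h_strong) => //.
apply: le_trans D00.
exact: (le_bigmax _ (fun s => action_div h (pistar s) (pi0 s))).
Qed.

End Run.

(** With [q] for [(1 - gamma)^-1], this choice of [eta] turns the averaged mirror descent term into
    exactly the square root of the bound. Both sides are nonnegative, so their squares are
    compared. *)
Lemma optimal_step_balance (R : realType) (alpha lambda sigma q D n NK : R) :
  0 < alpha -> 0 < lambda -> 0 < sigma -> 0 < q -> 0 < D -> 0 < n -> 0 < NK ->
  let eta := Num.sqrt (alpha * lambda * sigma ^+ 2 * q ^- 4 * D / (6 * n ^+ 2 * NK)) in
  NK^-1 * (q * D / eta) =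
  (Num.sqrt NK)^-1 * Num.sqrt (6 * n ^+ 2 * D / (alpha * lambda * sigma ^+ 2 * q ^- 6)).
Proof.
move=> a0 l0 s0 q0 D0 n0 NK0 eta.
have e0 : 0 < eta.
  by rewrite sqrtr_gt0 divr_gt0// ?mulr_gt0// ?invr_gt0 ?exprn_gt0.
have L0 : 0 <= NK^-1 * (q * D / eta).
  by rewrite mulr_ge0 ?invr_ge0 ?(ltW NK0)// divr_ge0 ?(ltW e0)// mulr_ge0 ?ltW.
have R0 : 0 <= (Num.sqrt NK)^-1 *
    Num.sqrt (6 * n ^+ 2 * D / (alpha * lambda * sigma ^+ 2 * q ^- 6)).
  by rewrite mulr_ge0 ?invr_ge0 ?sqrtr_ge0.
apply/eqP; rewrite -(@eqrXn2 _ 2 _ _ isT L0 R0).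
rewrite !exprMn !exprVn !sqr_sqrtr ?(ltW NK0)//; last 2 first.
- by rewrite ltW// divr_gt0// ?mulr_gt0// ?invr_gt0 ?exprn_gt0.
- by rewrite ltW// divr_gt0// ?mulr_gt0// ?invr_gt0 ?exprn_gt0.
by apply/eqP; field; rewrite !gt_eqF.
Qed.

(* All O(eta) terms together are at most the mirror descent term D / eta, which
   is why the bound has a factor 2. *)
Lemma drift_absorbed (R : realType) (alpha lambda sigma q D n NK eta : R) :
  0 < alpha <= 1 -> 0 < lambda -> 0 < sigma <= 1 -> 1 <= q -> 0 < D -> 0 < n -> 0 < NK ->
  eta = Num.sqrt (alpha * lambda * sigma ^+ 2 * q ^- 4 * D / (6 * n ^+ 2 * NK)) ->
  NK * (q ^+ 3 * (eta * q * n ^+ 2 / (2 * lambda)) / (alpha * sigma)) +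
  NK * (q ^+ 2 * (eta * q * n ^+ 2 / (2 * lambda)) / 2) <= q * D / eta.
Proof.
move=> /andP[a0 a1] l0 /andP[s0 s1] q1 D0 n0 NK0 etaE.
have q0 : 0 < q by lra.
have X0 : 0 < alpha * lambda * sigma ^+ 2 * q ^- 4 * D / (6 * n ^+ 2 * NK).
  by rewrite divr_gt0// ?mulr_gt0// ?invr_gt0 ?exprn_gt0.
have e0 : 0 < eta by rewrite etaE sqrtr_gt0.
rewrite ler_pdivlMr//.
have -> : (NK * (q ^+ 3 * (eta * q * n ^+ 2 / (2 * lambda)) / (alpha * sigma)) +
    NK * (q ^+ 2 * (eta * q * n ^+ 2 / (2 * lambda)) / 2)) * eta =
   eta ^+ 2 * (NK * (q ^+ 3 * (q * n ^+ 2 / (2 * lambda)) / (alpha * sigma)) +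
     NK * (q ^+ 2 * (q * n ^+ 2 / (2 * lambda)) / 2)) by ring.
rewrite etaE sqr_sqrtr ?(ltW X0)//.
have -> : alpha * lambda * sigma ^+ 2 * q ^- 4 * D / (6 * n ^+ 2 * NK) *
  (NK * (q ^+ 3 * (q * n ^+ 2 / (2 * lambda)) / (alpha * sigma)) +
     NK * (q ^+ 2 * (q * n ^+ 2 / (2 * lambda)) / 2)) =
  D * (sigma / 12 + alpha * sigma ^+ 2 / (24 * q)) by field; rewrite !gt_eqF.
rewrite mulrC ler_wpM2r ?(ltW D0)//.
have A : alpha * sigma ^+ 2 / (24 * q) <= 1 / 24.
  rewrite ler_pdivrMr ?mulr_gt0// expr2.
  have : alpha * (sigma * sigma) <= 1.
    by rewrite mulr_ile1 ?mulr_ge0 ?mulr_ile1 ?(ltW a0) ?(ltW s0).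
  lra.
lra.
Qed.

Theorem theorem3p13 (R : realType) (S A : finType) (M : @mdp R S A)
  (h : 'rV[R]_#|A| -> \bar R) (hh : mirror_map h)
  (lambda : R) (lambda_gt0 : 0 < lambda)
  (p : \bar R) (p_ge1 : (1 <= p)%E)
  (h_strong : strongly_convex_on vsimplex lambda p h)
  (pib : S -> A -> R) (pib_policy : policies pib)
  (pib_gt0 : 0 < min_prob pib)
  (pib_ergodic : ergodic (state_trans M pib))
  (nu : S -> R) (nu_stationary : stationary (state_trans M pib) nu)
  (m_b kappa_b : R) (m_b_gt0 : 0 < m_b) (kappa_b_itv : 0 < kappa_b < 1)
  (mixing : forall s t,
     tv_dist nu (steps (state_trans M pib) t s) <= m_b * kappa_b ^+ t)
  (pi0 : S -> A -> R) (pi0_policy : policies pi0)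
  (pi0_rint : forall s, rel_interior (dom h) (vec (pi0 s)))
  (s0 : S) (K B : nat) (B_gt0 : (0 < B)%N)
  (alpha theta : R) (alpha_itv : 0 < alpha <= 1) (theta_itv : 0 <= theta <= 1)
  (pistar : S -> A -> R) (pistar_optimal : optimal M pistar)
  (mu : S -> R) (mu_simplex : simplex mu)
  (d : measure_display) (Omega : measurableType d) (P : probability Omega R)
  (X : nat -> Omega -> S) (Y : nat -> Omega -> A)
  (XY_trajectory : is_trajectory M X Y P pib s0 (batch_start (fun=> B) K.+1))
  (Khat : Omega -> 'I_K.+1)
  (Khat_uniform :
     independent_uniform P X Y (batch_start (fun=> B) K.+1) Khat)
  (Q pi : Omega -> nat -> S -> A -> R) :
  let gamma := discount M in
  let sigma := min_prob (fun s a => nu s * pib s a) in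
  let D0 := div_norm h pistar pi0 in
  let nA : R := #|A|%:R in
  let nK : R := K.+1%:R in
  let eta := Num.sqrt (alpha * lambda * sigma ^+ 2 * (1 - gamma) ^+ 4 * D0 /
                       (6 * nA ^+ 2 * nK)) in
  (forall w, td_pmd_run h M K pi0 (fun=> eta) (fun=> alpha) (fun=> B)
     (fun=> geometric_weight theta B)
     (fun t => X t w) (fun t => Y t w) (Q w) (pi w)) ->
  ('E_P[fun w => (expect mu (opt_value M)
                  - expect mu (value M (pi w (Khat w))))%R] <=
   (1 / nK * (3 / (alpha * sigma * (1 - gamma) ^+ 3))
    + 2 / Num.sqrt nK *
        Num.sqrt (6 * nA ^+ 2 * D0 /
                  (alpha * lambda * sigma ^+ 2 * (1 - gamma) ^+ 6))
    + 2 / (sigma * (1 - gamma) ^+ 2) * Psi gamma B theta m_b kappa_b)%:E)%E.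
Proof.
move=> gamma sigma D0 nA nK eta run.
have g01 := discount_itv M; have q0 : 0 < (1 - gamma)^-1 by rewrite invr_gt0 onem_gamma_gt0.
have q1 : 1 <= (1 - gamma)^-1.
  rewrite invf_ge1 ?onem_gamma_gt0//; have := gamma_ge0 M; rewrite -/gamma; lra.
have [pistar_policy pistarE] := pistar_optimal.
have pi0_int s : (dom h)° (vec (pi0 s)).
  by rewrite -(rel_interiorE (mirror_essentially_smooth hh)).
have [a0 a1] := andP alpha_itv.
have hT s := state_trans_simplex M s pib_policy.
have nu0 s : 0 < nu s by exact: (stationary_gt0 s hT (proj1 pib_ergodic)).
have sigma0 : 0 < sigma.
  apply: min_prob_gt0 => s a; rewrite mulr_gt0//.
  by apply: lt_le_trans pib_gt0 _; exact: min_prob_le.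
have sigma1 : sigma <= 1 by exact: min_prob_le1.
have sigma_ge s a : sigma <= nu s * pib s a.
  exact: (min_prob_le (fun s a => nu s * pib s a)).
have eta0 : 0 <= eta by exact: sqrtr_ge0.
have nA0 : 0 < nA by rewrite ltr0n; exact: action_nonempty M.
have nK0 : 0 < nK by rewrite ltr0n.
(* Mixing holds from every start state, so it controls each law in a batch whatever state opens it;
   averaging with the weights gives a bias bound uniform over sample points. *)
pose beta := \sum_(t < B) geometric_weight theta B t * (m_b * kappa_b ^+ t).
have bias w k s : `|batch_prob M pib B theta X w k s - nu s| <= beta.
  rewrite /batch_prob -[nu s]mul1r -(geometric_weight_sum B_gt0 theta_itv) mulr_suml.
  rewrite -sumrB; apply: le_trans (ler_norm_sum _ _ _) _; apply: ler_sum => t _.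
  rewrite -mulrBr normrM ger0_norm ?geometric_weight_ge0// ler_wpM2l ?geometric_weight_ge0//.
  apply: le_trans (mixing (X (k * B)%N w) t); rewrite distrC.
  by apply: tv_dist_ge; [case: nu_stationary|exact: steps_simplex].
have Psi_ge := geometric_bias_le B_gt0 theta_itv g01 m_b_gt0 kappa_b_itv.
have beta0 : 0 <= beta.
  apply: sumr_ge0 => t _; rewrite mulr_ge0 ?geometric_weight_ge0//.
  by rewrite mulr_ge0 ?exprn_ge0 ?(ltW m_b_gt0)//; case/andP: kappa_b_itv => /ltW.
have D0_ge0 : 0 <= D0 by exact: bigmax_ge_id.
(* [Psi] dominates [beta / (1 - gamma)], and [1 <= (1 - gamma)^-1]. *)
have Psi0 : beta <= Psi gamma B theta m_b kappa_b.
  by apply: le_trans Psi_ge; rewrite ler_peMl.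
rewrite (expectation_value_diff hh lambda_gt0 p_ge1 h_strong mu pi0_policy
  pi0_int pistar_policy XY_trajectory run Khat_uniform pistarE) lee_fin.
rewrite -/nK.
have g0 : 0 < 1 - gamma := onem_gamma_gt0 M.
have rate_ge0 : 0 <= 1 / nK * (3 / (alpha * sigma * (1 - gamma) ^+ 3)).
  by rewrite mulr_ge0 ?divr_ge0 ?mulr_ge0 ?exprn_ge0 ?(ltW g0) ?(ltW nK0) ?(ltW a0) ?(ltW sigma0).
have [D0_gt0|D0_le0] := ltP 0 D0; last first.
  have eta_eq0 : eta = 0.
    by rewrite /eta (_ : D0 = 0) ?mulr0 ?mul0r ?sqrtr0//; apply/le_anti; rewrite D0_le0.
  rewrite big1 ?mulr0 => [|k _].
    rewrite addr_ge0 ?addr_ge0//.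
    apply: mulr_ge0; last exact: le_trans beta0 Psi0.
    by apply: divr_ge0 => //; apply: mulr_ge0; [exact: ltW|exact/exprn_ge0/ltW].
  rewrite -[RHS](traj_expect_cst pib_policy XY_trajectory); apply: eq_traj_expect => w.
  exact: (value_diff0 hh lambda_gt0 p_ge1 h_strong mu pi0_policy pi0_int
    pistar_policy B_gt0 eta0 alpha_itv theta_itv run w eta_eq0 D0_le0 (ltnW (ltn_ord k))).
set q := (1 - gamma)^-1 in q0 q1 Psi_ge.
have etaE : eta = Num.sqrt (alpha * lambda * sigma ^+ 2 * q ^- 4 * D0 / (6 * nA ^+ 2 * nK)).
  by rewrite /q exprVn invrK.
have eta_gt0 : 0 < eta.
  by rewrite etaE sqrtr_gt0 divr_gt0// ?mulr_gt0// ?invr_gt0 ?exprn_gt0.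
have main := value_diff_sum_le hh lambda_gt0 p_ge1 h_strong pib_policy pi0_policy
  pi0_int pistar_policy mu_simplex B_gt0 eta0 alpha_itv theta_itv XY_trajectory run
  nu_stationary bias sigma0 sigma_ge eta_gt0.
have alpha_sigma0 : 0 < alpha * sigma by exact: mulr_gt0.
have sigma01 : 0 < sigma <= 1 by rewrite sigma0.
have drift := drift_absorbed alpha_itv lambda_gt0 sigma01 q1 D0_gt0 nA0 nK0 etaE.
have balance := optimal_step_balance a0 lambda_gt0 sigma0 q0 D0_gt0 nA0 nK0.
rewrite /= -etaE in balance.
(* There are only [K] differences between [K.+1] occupancies; rounding up to [nK] gives the form
   that [drift_absorbed] takes. *)
have K_le : K%:R * (q ^+ 3 * (eta * q * nA ^+ 2 / (2 * lambda)) / (alpha * sigma)) <=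
    nK * (q ^+ 3 * (eta * q * nA ^+ 2 / (2 * lambda)) / (alpha * sigma)).
  rewrite ler_wpM2r ?ler_nat// divr_ge0 ?(ltW alpha_sigma0)// mulr_ge0 ?exprn_ge0 ?(ltW q0)//.
  by rewrite divr_ge0 ?mulr_ge0 ?exprn_ge0 ?(ltW q0) ?(ltW nA0) ?(ltW lambda_gt0).
set V := \sum_(k < K.+1) _ in main *.
(* One copy of [q * D0 / eta] comes from mirror descent, the other absorbs the drift of the
   policies. *)
have V_le : V <= q ^+ 2 / (alpha * sigma) + nK * (2 * q ^+ 2 * beta / sigma) + 2 * (q * D0 / eta).
  rewrite -/gamma -/q -/nA -/nK -/D0 in main.
  by move: main K_le drift; lra.
have -> : 2 / Num.sqrt nK *
    Num.sqrt (6 * nA ^+ 2 * D0 / (alpha * lambda * sigma ^+ 2 * (1 - gamma) ^+ 6)) =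
    2 * (nK^-1 * (q * D0 / eta)).
  have -> : (1 - gamma) ^+ 6 = q ^- 6 by rewrite /q exprVn invrK.
  by rewrite balance -[LHS]mulrA.
have -> : 1 / nK * (3 / (alpha * sigma * (1 - gamma) ^+ 3)) =
    nK^-1 * (3 * q ^+ 3 / (alpha * sigma)).
  by rewrite /q; field; rewrite !gt_eqF.
have -> : 2 / (sigma * (1 - gamma) ^+ 2) * Psi gamma B theta m_b kappa_b =
    nK^-1 * (nK * (2 * q ^+ 2 / sigma * Psi gamma B theta m_b kappa_b)).
  by rewrite /q; field; rewrite !gt_eqF.
rewrite [2 * (nK^-1 * _)]mulrCA -!mulrDr ler_wpM2l ?invr_ge0 ?(ltW nK0)//.
apply: le_trans V_le _; rewrite -!addrA [X in _ <= _ + X]addrC; apply: lerD; last apply: lerD => //.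
  (* The boundary term has only [q ^+ 2], which is at most [3 * q ^+ 3] because [1 <= q]. *)
  rewrite ler_wpM2r ?invr_ge0 ?(ltW alpha_sigma0)// exprS.
  by have := sqr_ge0 q; nra.
rewrite ler_wpM2l ?(ltW nK0)// mulrAC ler_wpM2l// divr_ge0 ?(ltW sigma0)//.
by rewrite mulr_ge0 ?exprn_ge0 ?(ltW q0).
Qed.
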